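(* Suppose the request processes $\Phi_1,\dots,\Phi_N$ are independent stationary renewal processes with finite intensities $\lambda_i>0$, whose inter-arrival distributions $F_0^{(i)}$ have densities $f_0^{(i)}$ and hazard rates $\eta_i(t)=f_0^{(i)}(t)/(1-F_0^{(i)}(t))$, and let $C<N$ be the memory capacity. Then the optimal causal policy (the one maximizing, among all causal policies, the hit rate and the hit probability) is, at each time $t$: rank all items in decreasing order of the current interval hazard rates $\eta_i(t-\tau_i^-(t))$, and store in memory the first $C$ items in the ranking, where $\tau_i^-(t)$ is the last point of $\Phi_i$ strictly before $t$.
   Context: Framework: $(\Omega,\mathcal{F},P)$ carries a measurable flow $\{\vartheta_t\}$ preserving $P$; stationary point processes and stationary stochastic processes are compatible with the flow. The Palm probability of a stationary point process $\Phi$ of intensity $\lambda=\mathrm{E}[\Phi((0,1])]$ is $P^0_\Phi(A)=\frac1\lambda\mathrm{E}[\int_{(0,1]}\mathbf{1}_A(\vartheta_s\omega)\Phi(ds)]$. A stationary renewal process is a stationary simple point process whose inter-arrival times are i.i.d. under its Palm probability. $\mathcal{F}_t=\sigma(\mathcal{F}_t^{(i)};i=1,\dots,N)$, where $\mathcal{F}_t^{(i)}=\sigma(\Phi_i((a,b]):a<b\le t)$. The predictable $\sigma$-algebra on $\mathbb{R}\times\Omega$ is generated by sets $(a,b]\times A$, $a<b$, $A\in\mathcal{F}_a$. A causal policy is a stationary process $\mathcal{C}(t)$, measurable with respect to the predictable $\sigma$-algebra of $\{\mathcal{F}_t\}$, with values in the subsets of $\{1,\dots,N\}$ of size at most $C$.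 Its hit process is $\Psi_{\mathcal{C}}(B)=\sum_{i=1}^N\int_B\mathbf{1}_{\{i\in\mathcal{C}(t)\}}\Phi_i(dt)$, its hit rate is $h_{\mathcal{C}}=\mathrm{E}[\Psi_{\mathcal{C}}((0,1])]$, and its hit probability is $H_{\mathcal{C}}=P^0_\Phi(\Psi_{\mathcal{C}}(\{0\})=1)$ with $\Phi=\sum_i\Phi_i$. Ties in the ranking are broken by an arbitrary fixed deterministic rule. *)

(* Defs.v *)
From HB Require Import structures.
From mathcomp Require Import all_boot all_order all_algebra perm.
From mathcomp Require Import all_classical all_reals all_analysis.
From mathcomp Require Import measurable_realfun.
Set Implicit Arguments.
Unset Strict Implicit.
Unset Printing Implicit Defensive.
Import Order.TTheory GRing.Theory Num.Theory numFieldNormedType.Exports.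
Local Open Scope classical_set_scope.
Local Open Scope ring_scope.
Local Open Scope ereal_scope.

Section Flow.
Context {d : measure_display} {Omega : measurableType d} {R : realType}.
Implicit Types (P : probability Omega R) (theta : R -> Omega -> Omega).

Definition measurable_flow theta :=
  [/\ measurable_fun [set: R * Omega] (fun p => theta p.1 p.2),
      forall w, theta 0%R w = w &
      forall s t w, theta (s + t)%R w = theta s (theta t w)].

Definition flow_preserves P theta :=
  forall t (A : set Omega), measurable A -> P (theta t @^-1` A) = P A.

End Flow.

(* A random measure on the line is a kernel from Omega to R, i.e. a family of
   measures w |-> Phi w such that w |-> Phi w B is measurable for all Borel B. *)
Section PointProcess.
Context {d : measure_display} {Omega : measurableType d} {R : realType}.
Implicit Types (P : probability Omega R) (theta : R -> Omega -> Omega).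
Implicit Types (Phi : R.-ker Omega ~> R).

(* Integer-valued on bounded Borel sets; in particular locally finite. *)
Definition point_process Phi :=
  forall w (a b : R) (B : set R), measurable B -> B `<=` `[a, b]%classic ->
    exists n : nat, Phi w B = n%:R%:E.

Definition flow_compatible theta Phi :=
  forall t w (B : set R), measurable B ->
    Phi (theta t w) B = Phi w [set (x + t)%R | x in B].

Definition stationary_point_process theta Phi :=
  point_process Phi /\ flow_compatible theta Phi.

Definition simple_process P Phi :=
  {ae P, forall w, forall t : R, Phi w [set t] <= 1}.

Definition intensity P Phi : \bar R := \int[P]_w Phi w `]0%R, 1%R]%classic.

Definition palm P theta Phi (A : set Omega) : \bar R :=
  ((fine (intensity P Phi))^-1)%:E *
  \int[P]_w \int[Phi w]_(s in `]0%R, 1%R]%classic) (\1_A (theta s w))%:E.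

End PointProcess.

Section Points.
Context {R : realType}.
Implicit Types (m : set R -> \bar R) (t : R).

(* tau^-(t), equal to -oo when there is no point before t. *)
Definition last_before m t : \bar R :=
  ereal_sup [set s%:E | s in [set s : R | (s < t)%R /\ 0 < m [set s]]].

(* +oo when there is no point after t. *)
Definition next_after m t : \bar R :=
  ereal_inf [set s%:E | s in [set s : R | (t < s)%R /\ 0 < m [set s]]].

Definition last_upto m t : \bar R :=
  ereal_sup [set s%:E | s in [set s : R | (s <= t)%R /\ 0 < m [set s]]].

(* The n-th point T_n, numbered so that ... < T_(-1) < T_0 <= 0 < T_1 < ...
   [fine] only matters for realizations with a first or a last point (or none);
   almost no realization is such under the Palm probability of a stationary
   process, which is where the numbering is used. *)
Definition point m (n : int) : R :=
  let T0 := fine (last_upto m 0%R) in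
  match n with
  | Posz k => iter k (fun t => fine (next_after m t)) T0
  | Negz k => iter k.+1 (fun t => fine (last_before m t)) T0
  end.

Definition inter_arrival m (n : int) : R := (point m (n + 1) - point m n)%R.

End Points.

Section Renewal.
Context {d : measure_display} {Omega : measurableType d} {R : realType}.
Implicit Types (P : probability Omega R) (theta : R -> Omega -> Omega).
Implicit Types (Phi : R.-ker Omega ~> R).

Definition iid_inter_arrivals P theta Phi :=
  (forall (n : int) (B : set R), measurable B ->
     palm P theta Phi [set w | B (inter_arrival (Phi w) n)] =
     palm P theta Phi [set w | B (inter_arrival (Phi w) 0)]) /\
  (forall (J : seq int) (B : int -> set R), uniq J ->
     (forall n, measurable (B n)) ->
     palm P theta Phi
       [set w | forall n, n \in J -> B n (inter_arrival (Phi w) n)] =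
     \prod_(n <- J) palm P theta Phi [set w | B n (inter_arrival (Phi w) n)]).

Definition stationary_renewal P theta Phi :=
  [/\ stationary_point_process theta Phi, simple_process P Phi &
      iid_inter_arrivals P theta Phi].

Definition inter_arrival_cdf P theta Phi (t : R) : R :=
  fine (palm P theta Phi [set w | (inter_arrival (Phi w) 0 <= t)%R]).

Definition is_density (F f : R -> R) :=
  [/\ measurable_fun [set: R] f, forall t, (0 <= f t)%R &
      forall t, (F t)%:E =
        \int[lebesgue_measure]_(u in `]-oo, t]%classic) (f u)%:E].

Definition hazard_rate (F f : R -> R) (t : R) : R := (f t / (1 - F t))%R.

End Renewal.

Section Superposition.
Context {d : measure_display} {Omega : measurableType d} {R : realType}.
Context {N : nat} (Phi : 'I_N -> R.-ker Omega ~> R).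

Definition superposition (w : Omega) (B : set R) : \bar R :=
  \sum_(i < N) Phi i w B.

Let superposition0 w : superposition w set0 = 0.
Proof. by rewrite /superposition big1. Qed.

Let superposition_ge0 w B : 0 <= superposition w B.
Proof. exact: sume_ge0. Qed.

Let superposition_sigma_additive w : semi_sigma_additive (superposition w).
Proof.
move=> F mF tF mUF; rewrite [X in _ --> X](_ : _ =
    limn (fun n => \sum_(0 <= i < n) superposition w (F i))); last first.
  rewrite nneseries_sum//; apply: eq_bigr => /= i _.
  exact: measure_semi_bigcup.
by apply: is_cvg_nneseries => k _ _; exact: superposition_ge0.
Qed.

HB.instance Definition _ w := isMeasure.Build _ _ _ (superposition w)
  (superposition0 w) (superposition_ge0 w) (@superposition_sigma_additive w).

Let superpositionM (w : Omega) : {measure set R -> \bar R} := superposition w.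

Let measurable_superposition (B : set R) : measurable B ->
  measurable_fun [set: Omega] (superpositionM ^~ B).
Proof.
by move=> mB; apply: emeasurable_sum => i _; exact: measurable_kernel.
Qed.

Definition superposition_kernel (w : Omega) : {measure set R -> \bar R} :=
  superposition w.

HB.instance Definition _ := isKernel.Build _ _ _ _ _ superposition_kernel
  measurable_superposition.

End Superposition.

Section Caching.
Context {d : measure_display} {Omega : measurableType d} {R : realType}.
Context {N : nat}.
Implicit Types (P : probability Omega R) (theta : R -> Omega -> Omega).
Implicit Types (Phi : 'I_N -> R.-ker Omega ~> R).
Implicit Types (pol : R -> Omega -> {set 'I_N}).

Definition process_sigma (Psi : R.-ker Omega ~> R) : set (set Omega) :=
  <<s \bigcup_(B in [set B : set R | measurable B])
        preimage_set_system setT (fun w => Psi w B) measurable >>.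

(* Mutual independence of the N processes. Subfamilies need no separate mention,
   as some of the A i may be the whole of Omega. *)
Definition independent_processes P Phi :=
  forall A : 'I_N -> set Omega, (forall i, process_sigma (Phi i) (A i)) ->
    P [set w | forall i, A i w] = \prod_(i < N) P (A i).

Definition process_history (Psi : R.-ker Omega ~> R) (t : R) :
    set (set Omega) :=
  <<s \bigcup_(I in [set I : R * R | (I.1 < I.2)%R /\ (I.2 <= t)%R])
        preimage_set_system setT (fun w => Psi w `]I.1, I.2]%classic)
          measurable >>.

Definition history Phi (t : R) : set (set Omega) :=
  <<s \bigcup_(i in [set: 'I_N]) process_history (Phi i) t >>.

Definition predictable Phi : set (set (R * Omega)) :=
  <<s [set E | exists a b A,
        [/\ (a < b)%R, history Phi a A & E = `]a, b]%classic `*` A]] >>.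

Definition causal_policy theta Phi (C : nat) pol :=
  [/\ forall t w, (#|pol t w| <= C)%N,
      forall s t w, pol s (theta t w) = pol (s + t)%R w &
      forall S : {set 'I_N}, predictable Phi [set p | pol p.1 p.2 = S]].

Definition hit_process Phi pol (w : Omega) (B : set R) : \bar R :=
  \sum_(i < N) \int[Phi i w]_(t in B) (\1_[set t | i \in pol t w] t)%:E.

Definition hit_rate P Phi pol : \bar R :=
  \int[P]_w hit_process Phi pol w `]0%R, 1%R]%classic.

Definition hit_probability P theta Phi pol : \bar R :=
  palm P theta (superposition_kernel Phi)
    [set w | hit_process Phi pol w [set 0%R] = 1].

Definition optimal_causal_policy P theta Phi (C : nat) pol :=
  causal_policy theta Phi C pol /\
  forall pol', causal_policy theta Phi C pol' ->
    hit_rate P Phi pol' <= hit_rate P Phi pol /\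
    hit_probability P theta Phi pol' <= hit_probability P theta Phi pol.

(* A deterministic rule ranking the items by decreasing value: rk v k is the
   item of rank k for the vector of values v. Ties are resolved in any way
   depending (measurably) on v only. *)
Definition ranking_rule (rk : N.-tuple R -> {perm 'I_N}) :=
  (forall v (j k : 'I_N), (j <= k)%N ->
     (tnth v (rk v k) <= tnth v (rk v j))%R) /\
  (forall s : {perm 'I_N}, measurable [set v | rk v = s]).

(* The hazard is 0 as long as no point has occurred. For a stationary process
   this happens, up to a null set, only on the event that it has no point. *)
Definition current_hazard P theta (Psi : R.-ker Omega ~> R) (f : R -> R)
    (t : R) (w : Omega) : R :=
  if last_before (Psi w) t is r%:E
  then hazard_rate (inter_arrival_cdf P theta Psi) f (t - r)%R
  else 0%R.

Definition hazard_policy P theta Phi (f : 'I_N -> R -> R)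
    (rk : N.-tuple R -> {perm 'I_N}) (C : nat) (t : R) (w : Omega) :
    {set 'I_N} :=
  let v := [tuple current_hazard P theta (Phi i) (f i) t w | i < N] in
  [set rk v k | k : 'I_N & (k < C)%N]%SET.

End Caching.

(* Main.v *)
(* The intensity of [Phi i] with respect to the joint history is its current
   interval hazard: for every predictable E,
     E[Phi_i {t | (t, w) in E}] = \int dt E[1_E(t, w) eta_i(t - tau_i^-(t))].
   Hence the hit rate of a causal policy is the integral over ]0, 1] x Omega of
   the sum of the current hazards of the stored items, and storing the C items
   of largest hazard maximizes the integrand pointwise.

   For E = ]a, b] x A with A a past event of [Phi i] at time a < t, both sides
   reduce to integrals of the (unnormalized) Palm mass of A o theta_(-t). For the
   left-hand side this is Mecke's formula. For the right-hand side, Mecke's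
   formula turns E[1_A eta_i] into \int_(u > 0) eta_i(u) Q(X_0 >= u, A seen at u),
   where Q is the Palm mass and X_0 the first inter-arrival time, while under Q
   the sequence of past inter-arrival times X_(-1), X_(-2), ... has the law of
   X_0, X_(-1), ...: conditioning on the first term gives the same integral.
   Independence of the processes extends this to finite intersections of past
   events of the N processes, and uniqueness of measures to all predictable E.

   Finally two independent stationary processes almost surely share no point
   (split ]0, 1] into n intervals: the probability is at most
   lambda_i lambda_j / n), so that the hit probability of every causal policy is
   its hit rate divided by the intensity of the superposition. *)
Require Import Defs.
From HB Require Import structures.
From mathcomp Require Import all_boot all_order all_algebra perm.
From mathcomp Require Import all_classical all_reals all_analysis.
From mathcomp Require Import measurable_realfun.
Import Order.TTheory GRing.Theory Num.Theory numFieldNormedType.Exports.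
Local Open Scope classical_set_scope.
Local Open Scope ring_scope.
Local Open Scope ereal_scope.

Set Implicit Arguments.
Unset Strict Implicit.
Unset Printing Implicit Defensive.

(** * Integer-valued measures and their points *)

(** The cancellation behind the result is eta (1 - F) = f: the probability that the current interval
    has lasted u is what the hazard divides by, so weighting survivors by the hazard restores the
    law of a full interval. The obstacle is that an event of the past at a < t must be read in two
    situations, from a point at t and from a time u after the last point, and that last point may
    lie on either side of a. One set of interval sequences serves both: prefixing the elapsed time u
    to the past intervals describes the configuration as if t were itself a point. Default values
    shape the rest. [fine] makes the numbered points meaningless on degenerate realizations, and
    division by 0 makes the hazard vanish where F = 1; both cases are shown negligible under the
    Palm mass itself, which may charge P-null events. No enumeration of the points is given in
    advance. Integer values supply one: such a measure leaves a gap on each side of every location,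
    so last and next points are attained, and it has no mass outside its atoms. *)

Lemma measure_null_le d (T : measurableType d) (R : realType)
    (m : {measure set T -> \bar R}) (A B : set T) : measurable A ->
  measurable B -> A `<=` B -> m B = 0 -> m A = 0.
Proof.
move=> mA mB AB B0; apply/eqP; rewrite -measure_le0 -B0.
by rewrite le_measure// inE.
Qed.

Lemma measure_null_diff d (T : measurableType d) (R : realType)
    (m : {measure set T -> \bar R}) (A B : set T) : measurable A ->
  measurable B -> m B = 0 -> m A = m (A `\` B).
Proof.
move=> mA mB B0; rewrite (measureDI m mA mB).
rewrite [X in _ + X](_ : _ = 0) ?adde0//.
apply: measure_null_le B0 => //; exact: measurableI.
Qed.

Lemma measureU_eq0 d (T : measurableType d) (R : realType)
    (m : {measure set T -> \bar R}) (A B : set T) : measurable A ->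
  measurable B -> m A = 0 -> m B = 0 -> m (A `|` B) = 0.
Proof. by move=> mA mB A0 B0; rewrite measureU0. Qed.

Lemma indic_iff (R : realType) T T' (A : set T) (B : set T') x y :
  (A x <-> B y) -> \1_A x = \1_B y :> R.
Proof.
by move=> AB; rewrite !indicE; congr (nat_of_bool _)%:R; apply/idP/idP;
  rewrite !inE => /AB.
Qed.

Section NatMeasure.
Context {R : realType}.
Implicit Types (m : {measure set R -> \bar R}) (r t a b : R).

Definition nat_valued m := forall a b (B : set R), measurable B ->
  B `<=` `[a, b]%classic -> exists n : nat, m B = n%:R%:E.

Lemma nat_valued_lty m a b (B : set R) : nat_valued m -> measurable B ->
  B `<=` `[a, b]%classic -> m B < +oo.
Proof. by move=> mnat mB /(mnat _ _ _ mB)[n ->]; rewrite ltry. Qed.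

Lemma nat_valued_lt1 m a b (B : set R) : nat_valued m -> measurable B ->
  B `<=` `[a, b]%classic -> m B < 1 -> m B = 0.
Proof.
move=> mnat mB /(mnat _ _ _ mB)[n ->].
by rewrite (_ : 1 = 1%:R%:E)// lte_fin ltr_nat; case: n.
Qed.

Lemma bigcap_shrinking_itv (l u : nat -> R) r :
  (forall e : R, (0 < e)%R -> exists n, (r - e <= l n)%R /\ (u n <= r + e)%R) ->
  (forall n, (r <= l n)%R \/ (u n <= r)%R) ->
  \bigcap_n `]l n, u n[%classic = set0.
Proof.
move=> H side; apply/seteqP; split => // x Hx.
have [xr|rx|xr] := ltgtP x r.
- have [n [ln un]] := H (r - x)%R ltac:(by rewrite subr_gt0).
  have := Hx n I; rewrite /= in_itv/= => /andP[]; rewrite opprB addrC subrK in ln.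
  by move=> /(le_lt_trans ln); rewrite ltxx.
- have [n [ln un]] := H (x - r)%R ltac:(by rewrite subr_gt0).
  have := Hx n I; rewrite /= in_itv/= => /andP[_]; rewrite addrC subrK in un.
  by move=> /lt_le_trans => /(_ _ un); rewrite ltxx.
- have := Hx 0%N I; rewrite /= in_itv/= xr => /andP[h1 h2].
  by have [|] := side 0%N; rewrite leNgt ?h1 ?h2.
Qed.

(** Continuity from above sends the masses to 0, and integers that tend to 0 are eventually 0. The
    second condition keeps r outside the open intervals, so that both one-sided gap lemmas are
    instances. *)
Lemma nat_valued_shrink m r (l u : nat -> R) : nat_valued m ->
  (forall e : R, (0 < e)%R -> exists n, (r - e <= l n)%R /\ (u n <= r + e)%R) ->
  (forall n, (r <= l n)%R \/ (u n <= r)%R) ->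
  {homo l : n m / (n <= m)%N >-> (n <= m)%R} ->
  {homo u : n m / (n <= m)%N >-> (m <= n)%R} ->
  exists n, m `]l n, u n[%classic = 0.
Proof.
move=> mnat H side lnd uni.
have sub n : `]l n, u n[%classic `<=` `[l 0%N, u 0%N]%classic.
  apply: subset_itv; rewrite bnd_simp; first exact: lnd.
  exact: uni.
have cap0 := bigcap_shrinking_itv H side.
have : m (`]l n, u n[%classic) @[n --> \oo] --> m (\bigcap_n `]l n, u n[%classic).
  apply: nonincreasing_cvg_mu => //.
  - exact: (nat_valued_lty mnat _ (sub 0%N)).
  - by rewrite cap0.
  - move=> i j ij; apply/subsetPset; apply: subset_itv; rewrite bnd_simp.
      exact: lnd.
    exact: uni.
rewrite cap0 measure0 => /fine_cvgP[finm].
move=> /cvgrPdist_lt/(_ 1%R ltr01)[k _ kP].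
case: finm => k' _ k'P.
exists (maxn k k').
have := kP (maxn k k') (leq_maxl _ _).
rewrite /= sub0r normrN => h.
apply: (nat_valued_lt1 mnat _ (@sub _)) => //.
rewrite -[X in X < _]fineK; last exact: k'P (leq_maxr _ _).
by rewrite lte_fin (le_lt_trans _ h)// ler_norm.
Qed.

Lemma nat_valued_gap_left m r : nat_valued m ->
  exists2 e : R, (0 < e)%R & m `](r - e)%R, r[%classic = 0.
Proof.
move=> mnat.
have [||//|//|n mn] := @nat_valued_shrink m r (fun n => r - n.+1%:R^-1)%R
  (fun=> r) mnat.
- move=> e e0; exists (Num.truncn e^-1); split; last by rewrite lerDl ltW.
  rewrite lerB// -[leRHS]invrK lef_pV2 ?posrE ?invr_gt0//.
  by rewrite ltW// truncnS_gt.
- by move=> n; right.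
- move=> i j ij; rewrite lerB// lef_pV2 ?posrE//.
  by rewrite ler_nat.
- by exists (n.+1%:R^-1)%R; rewrite ?invr_gt0.
Qed.

Lemma nat_valued_gap_right m r : nat_valued m ->
  exists2 e : R, (0 < e)%R & m `]r, (r + e)%R[%classic = 0.
Proof.
move=> mnat.
have [||//||n mn] := @nat_valued_shrink m r (fun=> r)
  (fun n => r + n.+1%:R^-1)%R mnat.
- move=> e e0; exists (Num.truncn e^-1); split; first by rewrite gerBl ltW.
  rewrite lerD2l// -[leRHS]invrK lef_pV2 ?posrE ?invr_gt0//.
  by rewrite ltW// truncnS_gt.
- by move=> n; left.
- move=> i j ij; rewrite lerD2l// lef_pV2 ?posrE//.
  by rewrite ler_nat.
- by exists (n.+1%:R^-1)%R; rewrite ?invr_gt0.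
Qed.

Lemma bigcup_measure0 m (F : nat -> set R) : (forall n, measurable (F n)) ->
  (forall n, m (F n) = 0) -> m (\bigcup_n F n) = 0.
Proof.
move=> mF F0; apply/measure_negligible; first exact: bigcupT_measurable.
by apply: negligible_bigcup => n; exists (F n); split.
Qed.

(** Let [s0] be the infimum of the x such that ]a, x[ has mass. To its left there is no mass by
    definition; the gaps on its two sides, together with the absence of an atom at [s0], push
    nullity strictly beyond [s0], against the choice of the infimum. *)
Lemma no_atoms_itv m a b : nat_valued m ->
  (forall s, (a < s < b)%R -> m [set s] = 0) -> m `]a, b[%classic = 0.
Proof.
move=> mnat H; apply/eqP/negPn/negP => ab0.
pose S := [set x | [/\ (a < x)%R, (x <= b)%R & m `]a, x[%classic != 0]].
have ltab : (a < b)%R.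
  rewrite ltNge; apply/negP => ba; move: ab0.
  by rewrite set_itv_ge ?measure0 ?eqxx// bnd_simp -leNgt.
have Sb : S b by split.
have hS : has_inf S by split; [exists b|exists a => x [/ltW]].
pose s0 := inf S.
have as0 : (a <= s0)%R by apply: lb_le_inf; [exists b|move=> x [/ltW]].
have s0b : (s0 <= b)%R by apply: ge_inf => //; case: hS.
have [d d0 md] := nat_valued_gap_right s0 mnat.
have [e e0 me] := nat_valued_gap_left s0 mnat.
have [x Sx xs0] := inf_adherent d0 hS.
have s0x : (s0 <= x)%R by apply: ge_inf => //; case: hS.
case: Sx => ax xb /eqP; apply.
pose y := (s0 - e / 2)%R.
have y0 : m `]a, y[%classic = 0.
  have [ya|ay] := leP y a.
    by rewrite set_itv_ge ?measure0// bnd_simp -leNgt.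
  apply/eqP/negPn/negP => ymu.
  have ys0 : (y < s0)%R by rewrite /y gtrBl divr_gt0.
  have : S y by split => //; rewrite (le_trans (ltW ys0)).
  by move=> /(ge_inf (proj2 hS)); rewrite leNgt ys0.
(* [s0] may be an endpoint, about which [H] says nothing; hence the intersection. *)
have s00 : m ([set s0] `&` `]a, b[%classic) = 0.
  have [h|h] := boolP (a < s0 < b)%R.
    rewrite setIidl; first exact: H.
    by move=> _ ->; rewrite /= in_itv.
  rewrite (_ : _ `&` _ = set0) ?measure0//; apply/seteqP; split => // z [/= ->].
  by rewrite in_itv/= (negbTE h).
apply: (@measure_null_le _ _ _ _ _ (`]a, y[%classic `|` `](s0 - e)%R, s0[%classic `|`
  (([set s0] `&` `]a, b[%classic) `|` `]s0, (s0 + d)%R[%classic))) => //.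
- by apply: measurableU; apply: measurableU => //; exact: measurableI.
- move=> z; rewrite /= !in_itv/= => /andP[az zx].
  move: az zx; have [zs0|s0z|->] := ltgtP z s0 => az zx.
  + left; have [zy|yz] := ltP z y; first by left; rewrite az.
    right; rewrite andbT (lt_le_trans _ yz)// /y ltrD2l ltrN2.
    by rewrite ltr_pdivrMr// ltr_pMr// ltr1n.
  + by right; right; rewrite (lt_trans zx).
  + right; left; split => //.
    by rewrite /= az (lt_le_trans zx).
- apply: measureU_eq0 => //.
  + exact: measurableU.
  + by apply: measurableU => //; exact: measurableI.
  + exact: measureU_eq0.
  + by apply: measureU_eq0 => //; exact: measurableI.
Qed.

Lemma no_atoms_left m t : nat_valued m ->
  (forall s, (s < t)%R -> m [set s] = 0) -> m `]-oo, t[%classic = 0.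
Proof.
move=> mnat H; rewrite (_ : `]-oo, t[%classic =
    \bigcup_n `](t - n%:R)%R, t[%classic).
  apply: bigcup_measure0 => // n; apply: no_atoms_itv => // s /andP[_].
  exact: H.
apply/seteqP; split => [x|x [n _]]; rewrite /= !in_itv/=; last by case/andP.
move=> xt; exists (Num.truncn (t - x)%R).+1 => //.
rewrite /= in_itv/= xt andbT ltrBlDr -ltrBlDl.
by rewrite truncnS_gt.
Qed.

Lemma no_atoms_right m t : nat_valued m ->
  (forall s, (t < s)%R -> m [set s] = 0) -> m `]t, +oo[%classic = 0.
Proof.
move=> mnat H; rewrite (_ : `]t, +oo[%classic =
    \bigcup_n `]t, (t + n%:R)%R[%classic).
  apply: bigcup_measure0 => // n; apply: no_atoms_itv => // s /andP[+ _].
  exact: H.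
apply/seteqP; split => [x|x [n _]]; rewrite /= !in_itv/= ?andbT; last by case/andP.
move=> xt; exists (Num.truncn (x - t)%R).+1 => //.
by rewrite /= in_itv/= xt/= -ltrBlDl truncnS_gt.
Qed.

Lemma atom_in m (B : set R) s : measurable B -> B s -> m B = 0 -> m [set s] = 0.
Proof. by move=> mB Bs; apply: measure_null_le => // _ ->. Qed.

Variant last_before_spec m t : \bar R -> Prop :=
  | LastBeforeNone : m `]-oo, t[%classic = 0 -> last_before_spec m t -oo
  | LastBeforeSome r : (r < t)%R -> 0 < m [set r] -> m `]r, t[%classic = 0 ->
      last_before_spec m t r%:E.

(** The supremum is attained because of the gap to its left: an atom strictly inside that gap would
    contradict its nullity. *)
Lemma last_beforeP m t : nat_valued m -> last_before_spec m t (last_before m t).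
Proof.
move=> mnat; rewrite /last_before.
set S := [set s | (s < t)%R /\ 0 < m [set s]].
have [S0|/set0P[p Sp]] := eqVneq S set0.
  rewrite S0 image_set0 ereal_sup0; constructor.
  apply: no_atoms_left => // s st; apply/eqP/negPn/negP => ms.
  by have : S s by [split => //; rewrite lt0e ms measure_ge0]; rewrite S0.
have hS : has_sup S by split; [exists p|exists t => x [/ltW]].
rewrite ereal_sup_EFin//; [|by case: hS|by exists p].
set r := sup S.
have [e e0 me] := nat_valued_gap_left r mnat.
have [s Ss rs] := sup_adherent e0 hS.
have sr : (s <= r)%R by apply: ub_le_sup => //; case: hS.
have {}Ss : S r.
  move: sr; rewrite le_eqVlt => /orP[/eqP <-//|sr].
  have := @atom_in m _ s (measurable_itv `](r - e)%R, r[) _ me.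
  rewrite /= in_itv/= rs sr => /(_ isT) s0.
  by case: Ss => _; rewrite s0 ltxx.
case: Ss => rt mr; constructor => //.
apply: no_atoms_itv => // x /andP[rx xt].
apply/eqP/negPn/negP => mx.
have : S x by split => //; rewrite lt0e mx measure_ge0.
by move=> /(ub_le_sup (proj2 hS)); rewrite leNgt rx.
Qed.

Variant next_after_spec m t : \bar R -> Prop :=
  | NextAfterNone : m `]t, +oo[%classic = 0 -> next_after_spec m t +oo
  | NextAfterSome r : (t < r)%R -> 0 < m [set r] -> m `]t, r[%classic = 0 ->
      next_after_spec m t r%:E.

Lemma next_afterP m t : nat_valued m -> next_after_spec m t (next_after m t).
Proof.
move=> mnat; rewrite /next_after.
set S := [set s | (t < s)%R /\ 0 < m [set s]].
have [S0|/set0P[p Sp]] := eqVneq S set0.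
  rewrite S0 image_set0 ereal_inf0; constructor.
  apply: no_atoms_right => // s st; apply/eqP/negPn/negP => ms.
  by have : S s by [split => //; rewrite lt0e ms measure_ge0]; rewrite S0.
have hS : has_inf S by split; [exists p|exists t => x [/ltW]].
rewrite ereal_inf_EFin//; [|by case: hS|by exists p].
set r := inf S.
have [e e0 me] := nat_valued_gap_right r mnat.
have [s Ss rs] := inf_adherent e0 hS.
have sr : (r <= s)%R by apply: ge_inf => //; case: hS.
have {}Ss : S r.
  move: sr; rewrite le_eqVlt => /orP[/eqP ->//|sr].
  have := @atom_in m _ s (measurable_itv `]r, (r + e)%R[) _ me.
  rewrite /= in_itv/= rs sr => /(_ isT) s0.
  by case: Ss => _; rewrite s0 ltxx.
case: Ss => rt mr; constructor => //.
apply: no_atoms_itv => // x /andP[rx xt].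
apply/eqP/negPn/negP => mx.
have : S x by split => //; rewrite lt0e mx measure_ge0.
by move=> /(ge_inf (proj2 hS)); rewrite leNgt xt.
Qed.

Lemma last_upto_atom m t : 0 < m [set t] -> last_upto m t = t%:E.
Proof.
move=> mt; apply/eqP; rewrite eq_le; apply/andP; split.
  by apply: ge_ereal_sup => _ [s [st _] <-]; rewrite lee_fin.
by apply: ereal_sup_ubound; exists t.
Qed.

Lemma last_before_compat m m' t s :
  (forall x, m' [set x] = m [set x + s]%R) ->
  last_before m' t + s%:E = last_before m (t + s)%R.
Proof.
move=> H; rewrite /last_before.
apply/eqP; rewrite eq_le; apply/andP; split.
  rewrite -leeBrDr//; apply: ge_ereal_sup => _ [x [xt mx] <-].
  rewrite leeBrDr// -EFinD; apply: ereal_sup_ubound; exists (x + s)%R => //.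
  by split; [rewrite ltrD2r|rewrite -H].
apply: ge_ereal_sup => _ [x [xt mx] <-].
rewrite -leeBlDr// -EFinB; apply: ereal_sup_ubound; exists (x - s)%R => //.
by split; [rewrite ltrBlDr|rewrite H subrK].
Qed.

(** [Negz k] is the integer -(k + 1), so index 0 is the interval that ends at T_0. *)
Definition past m (k : nat) : R := inter_arrival m (Negz k).

(* The point numbered -k. *)
Definition back m (k : nat) : R :=
  iter k (fun t => fine (last_before m t)) (fine (last_upto m 0%R)).

Lemma past_back m k : past m k = (back m k - back m k.+1)%R.
Proof. by case: k => [|k]//; rewrite /past /inter_arrival/= subn1. Qed.

(** Positivity of the intervals also certifies that the numbering is genuine: where a neighbouring
    point is missing, [fine] returns 0, and the interval computed from it is at most 0. *)
Definition regular m := [/\ 0 < m [set 0%R], (0 < inter_arrival m 0)%R,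
  forall k, (0 < past m k)%R & forall k, m [set back m k] <= 1].

Lemma back0 m : regular m -> back m 0 = 0%R.
Proof. by case=> m0 _ _ _; rewrite /back/= last_upto_atom. Qed.

Lemma back_step m : nat_valued m -> regular m -> forall k,
  [/\ (back m k <= 0)%R, (back m k.+1 < back m k)%R,
      m [set back m k] = 1 & m `]back m k.+1, back m k[%classic = 0].
Proof.
move=> mnat mreg; have [m0 _ past_gt0 le1] := mreg.
have atom1 k : 0 < m [set back m k] -> m [set back m k] = 1.
  move=> mk; apply/eqP; rewrite eq_le le1 leNgt; apply/negP.
  move=> /(nat_valued_lt1 mnat (a := back m k) (b := back m k)) => H.
  by move: mk; rewrite H ?ltxx// set_itv1.
have step k : (back m k <= 0)%R -> [/\ (back m k.+1 < back m k)%R,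
    0 < m [set back m k.+1] & m `]back m k.+1, back m k[%classic = 0].
  move=> bk0; have bE : back m k.+1 = fine (last_before m (back m k)) by [].
  have := past_gt0 k; rewrite past_back bE.
  by case: (last_beforeP (back m k) mnat) => [_ /=|r r0 mr m0r _ //];
    rewrite subr0 ltNge bk0.
elim=> [|k [bk0 bk _ _]].
  have b00 : (back m 0 <= 0)%R by rewrite back0.
  have [? _ ?] := step 0%N b00; split => //.
  by apply: atom1; rewrite back0.
have bk1 : (back m k.+1 <= 0)%R by rewrite ltW// (lt_le_trans bk).
have [_ mk _] := step k bk0; have [? _ ?] := step k.+1 bk1; split => //.
exact: atom1.
Qed.

Lemma regular_next m : nat_valued m -> regular m ->
  m `]0%R, inter_arrival m 0[%classic = 0 /\ 0 < m [set inter_arrival m 0].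
Proof.
move=> mnat [m0 + _ _]; rewrite /inter_arrival/= last_upto_atom//= subr0.
by case: next_afterP => //= _; rewrite ltxx.
Qed.

(** Otherwise the decreasing points would accumulate at their infimum and enter the gap to the right
    of it. *)
Lemma back_lt m x : nat_valued m -> regular m -> exists k, (back m k < x)%R.
Proof.
move=> mnat mreg; apply/not_existsP => H.
have {}H k : (x <= back m k)%R by rewrite leNgt; apply/negP.
have hS : has_inf (range (back m)).
  by split; [exists (back m 0), 0%N|exists x => _ [k _ <-]].
have [e e0 me] := nat_valued_gap_right (inf (range (back m))) mnat.
have [_ [k _ <-] bke] := inf_adherent e0 hS.
have [_ _ + _] := back_step mnat mreg k.
rewrite (@atom_in m `]inf (range (back m)), (inf (range (back m)) + e)%R[%classic)//.
  by move/eqP; rewrite eq_sym onee_eq0.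
rewrite /= in_itv/= bke andbT.
have [_ bk _ _] := back_step mnat mreg k.
by apply: le_lt_trans bk; apply: ge_inf; [case: hS|exists k.+1].
Qed.

Lemma back_nonincreasing m : nat_valued m -> regular m ->
  {homo back m : i j / (i <= j)%N >-> (j <= i)%R}.
Proof.
move=> mnat mreg; apply: homo_leq => // [x y z /[swap]|k]; first exact: le_trans.
by have [_ /ltW + _ _] := back_step mnat mreg k.
Qed.

(** The half-line before the next point is cut into half-open cells, each of which carries its whole
    mass, equal to 1, at its left end. *)
Lemma regular_measure m (V : set R) : nat_valued m -> regular m ->
  measurable V -> V `<=` `]-oo, inter_arrival m 0[%classic ->
  m V = \sum_(k <oo) (\1_V (back m k))%:E.
Proof.
move=> mnat mreg mV VX.
(* Right end of cell k; cell 0 runs from the point 0 to the next point, where V stops. *)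
pose top k := if k is k'.+1 then back m k' else inter_arrival m 0.
pose I k := `[back m k, top k[%classic.
have lt_top k : (back m k < top k)%R.
  case: k => [|k]; first by rewrite back0//; case: mreg.
  by have [] := back_step mnat mreg k.
have I0 k : m `]back m k, top k[%classic = 0.
  case: k => [|k]; first by rewrite back0//; case: (regular_next mnat mreg).
  by have [] := back_step mnat mreg k.
have top_le i j : (i < j)%N -> (top j <= back m i)%R.
  by case: j => // j; rewrite ltnS => ij; exact: back_nonincreasing.
have VE : V = \bigcup_k (V `&` I k).
  rewrite -setI_bigcupr; apply/esym/setIidPl => x /VX; rewrite /= in_itv/= => xX.
  have exk : exists k, (back m k <= x)%R.
    by have [k /ltW bk] := back_lt x mnat mreg; exists k.
  exists (ex_minn exk) => //; case: ex_minnP => k bk kmin.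
  rewrite /I /= in_itv/= bk/=; case: k bk kmin => [//|k] bk kmin /=.
  by rewrite ltNge; apply/negP => /kmin; rewrite ltnn.
rewrite {1}VE measure_semi_bigcup//.
- apply: eq_eseriesr => k _.
  have -> : V `&` I k = (V `&` [set back m k]) `|` (V `&` `]back m k, top k[%classic).
    rewrite -setIUr; congr (_ `&` _); by rewrite /I -(@setU1itv _ _ _ _ false)// bnd_simp.
  rewrite measureU0//; [| | exact: measurableI|]; last first.
  + apply: (@measure_null_le _ _ _ _ _ `]back m k, top k[%classic) => //.
    exact: measurableI.
  + exact: measurableI.
  rewrite indicE; have [Vb|Vb] := boolP (back m k \in V).
    rewrite setIidr; last by move=> _ ->; rewrite -inE.
    by have [_ _ ->] := back_step mnat mreg k.
  rewrite (_ : _ `&` _ = set0) ?measure0//; apply/seteqP; split => // x [Vx /= xb].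
  by move: Vb; rewrite -xb mem_set.
- by move=> k; apply: measurableI => //; exact: measurable_itv.
- apply/trivIsetP => i j _ _; wlog ij : i j / (i < j)%N => [H|_].
    rewrite neq_ltn => /orP[ij|ji]; first by apply: H => //; rewrite neq_ltn ij.
    by rewrite setIC; apply: H => //; rewrite neq_ltn ji.
  apply/seteqP; split => // x [[_ +] [_]]; rewrite /I /= !in_itv/= => /andP[bx _].
  by move=> /andP[_ /lt_le_trans/(_ (top_le _ _ ij))]; rewrite ltNge bx.
- by rewrite -VE.
Qed.

Definition scons (u : R) (x : nat -> R) (n : nat) : R :=
  if n is k.+1 then x k else u.

(* The number of points in V of a configuration with a point at 0 and previous
   inter-arrival times x, the point at 0 being left out. *)
Definition hits (V : set R) (x : nat -> R) : \bar R :=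
  \sum_(k <oo) (\1_V (- \sum_(i < k.+1) x i)%R)%:E.

Lemma backE m k : regular m -> back m k = (- \sum_(i < k) past m i)%R.
Proof.
move=> mreg; elim: k => [|k IHk]; first by rewrite back0// big_ord0 oppr0.
by rewrite big_ord_recr/= past_back opprD -IHk opprB addrCA subrr addr0.
Qed.

Lemma nneseries_shift1 (h : nat -> \bar R) : (forall k, 0 <= h k) ->
  \sum_(1 <= k <oo) h k = \sum_(k <oo) h k.+1.
Proof.
move=> h0; apply/cvg_lim => //; rewrite -cvg_shiftS.
under eq_fun do rewrite big_add1 /=.
exact: is_cvg_nneseries.
Qed.

Lemma regular_hits m (V : set R) : nat_valued m -> regular m ->
  measurable V -> V `<=` `]-oo, 0%R[%classic -> m V = hits V (past m).
Proof.
move=> mnat mreg mV V0; rewrite regular_measure//; last first.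
  apply: (subset_trans V0); apply: subset_itvl; rewrite bnd_simp ltW//.
  by case: mreg.
rewrite nneseries_recl//.
rewrite back0// indicE memNset ?add0e; last by move/V0; rewrite /= in_itv/= ltxx.
rewrite nneseries_shift1; last by move=> k; rewrite lee_fin.
by apply: eq_eseriesr => k _; rewrite backE.
Qed.

(** Seen from u, the point at 0 lies at -u, which is the term k = 0 of the series. The bound on u
    keeps the next point out of the shifted V. *)
Lemma regular_hits_scons m (V : set R) u : nat_valued m -> regular m ->
  measurable V -> V `<=` `]-oo, 0%R[%classic -> (u <= inter_arrival m 0)%R ->
  m [set x | V (x - u)%R] = hits V (scons u (past m)).
Proof.
move=> mnat mreg mV V0 uX; rewrite regular_measure//.
- apply: eq_eseriesr => k _; congr (_%:E).
  rewrite big_ord_recl/= opprD addrC.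
  under eq_bigr do rewrite /=.
  by rewrite -backE// !indicE; congr (nat_of_bool _)%:R; apply/idP/idP; rewrite !inE.
- rewrite (_ : [set _ | _] = (fun x => x - u)%R @^-1` V)//.
  rewrite -[X in measurable X]setTI; exact: measurable_funB.
- move=> x /V0; rewrite /= !in_itv/= subr_lt0 => /lt_le_trans; exact.
Qed.

End NatMeasure.

(** * Measurability of the points *)

Section LebesgueShift.
Context {R : realType}.
Local Notation mu := (@lebesgue_measure R).

Lemma leb_shift (c : R) (A : set R) : measurable A ->
  mu [set x | A (x + c)%R] = mu A.
Proof.
move=> mA.
have mf : measurable_fun setT (fun x : R => x + c)%R by exact: measurable_funD.
apply/esym; apply: (@lebesgue_measure_unique R (pushforward mu
    ((fun x => x + c)%R : measurableTypeR R -> measurableTypeR R))) => //.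
move=> _ [[a b]] _ <-; rewrite /= /pushforward /=.
rewrite (_ : _ @^-1` _ = `](a - c)%R, (b - c)%R]%classic).
  rewrite !lebesgue_measure_itv/= !lte_fin ltrD2r -!EFinD.
  by rewrite opprD opprK addrACA addNr addr0.
by apply/seteqP; split => x; rewrite /= !in_itv/= ltrBlDr lerBrDr.
Qed.

Lemma ge0_integral_shift (h : R -> \bar R) (c : R) :
  measurable_fun [set: R] h -> (forall x, 0 <= h x) ->
  \int[mu]_x h (x + c)%R = \int[mu]_x h x.
Proof.
move=> mh h0.
transitivity (\int[pushforward mu ((fun x => x + c)%R :
    measurableTypeR R -> measurableTypeR R)]_x h x).
  by rewrite ge0_integral_pushforward//; exact: measurable_funD.
apply: eq_measure_integral => [|? A mA _]; last exact: leb_shift.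
exact: measurable_funD.
Qed.

Lemma ge0_integral_reflect (h : R -> \bar R) (c : R) :
  measurable_fun [set: R] h -> (forall x, 0 <= h x) ->
  \int[mu]_x h (c - x)%R = \int[mu]_x h x.
Proof.
move=> mh h0; rewrite -(ge0_integral_shift c mh h0).
have mN : measurable_fun setT (fun x : R => - x)%R by exact: oppr_measurable.
transitivity (\int[mu]_x ((fun x => h (x + c)%R) \o (fun x => - x)%R) x).
  by apply: eq_integral => x _ /=; rewrite addrC.
have mhc : measurable_fun setT (fun x : R => h (x + c)%R).
  by apply: (measurableT_comp mh); exact: measurable_funD.
transitivity (\int[pushforward mu (-%R : measurableTypeR R -> measurableTypeR R)]_x
    h (x + c)%R).
  by rewrite ge0_integral_pushforward.
by apply: eq_measure_integral => A mA _; exact: lebesgue_measureN.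
Qed.

End LebesgueShift.

(** * Tonelli's theorem and measurable integrals for integer-valued kernels *)

Section SigmaFinite.
Context {R : realType}.

Lemma nat_valued_sigma_finite (m : {measure set R -> \bar R}) :
  nat_valued m -> sigma_finite [set: R] m.
Proof.
move=> mnat; exists (fun n => `[(- n%:R)%R, n%:R]%classic).
  apply/esym/seteqP; split => // x _; exists (Num.truncn `|x|).+1 => //=.
  by rewrite in_itv/= -ler_norml ltW// truncnS_gt.
by move=> n; split; [exact: measurable_itv|exact: (nat_valued_lty mnat (measurable_itv _) (@subset_refl _ _))].
Qed.

(** A copy of [m] that carries the proof of integrality, to which the sigma-finite structure
    required by Tonelli's theorem can be attached. *)
Definition nat_measure (m : {measure set R -> \bar R}) (_ : nat_valued m) :
  set R -> \bar R := m.

HB.instance Definition _ m mnat := Measure.copy (@nat_measure m mnat) m.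

HB.instance Definition _ m mnat :=
  Measure_isSigmaFinite.Build _ _ _ (@nat_measure m mnat)
    (nat_valued_sigma_finite mnat).

Lemma nat_valued_tonelli d (T : measurableType d)
    (n : {sigma_finite_measure set T -> \bar R})
    (m : {measure set R -> \bar R}) (h : R * T -> \bar R) :
  nat_valued m -> measurable_fun setT h -> (forall p, 0 <= h p) ->
  \int[m]_x \int[n]_y h (x, y) = \int[n]_y \int[m]_x h (x, y).
Proof.
move=> mnat mh h0.
exact: (@fubini_tonelli _ _ _ _ _ (nat_measure mnat) n h mh h0).
Qed.

End SigmaFinite.

Section KernelMeasurability.
Context {R : realType} {d : measure_display} {T : measurableType d}.
Variable K : R.-ker T ~> R.
Hypothesis Knat : forall w, nat_valued (K w).

Section Reindex.
Context {d' : measure_display} {X : measurableType d'}.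
Variables (g : X -> T) (mg : measurable_fun setT g).

(** Pulling the kernel back along [g] lets sets and integrands depend on parameters other than the
    outcome, such as a time. *)
Definition kernel_reindex (x : X) : {measure set R -> \bar R} := K (g x).

Let measurable_kernel_reindex (U : set R) : measurable U ->
  measurable_fun setT (kernel_reindex ^~ U).
Proof.
by move=> mU; exact: (measurableT_comp (measurable_kernel K _ mU) mg).
Qed.

HB.instance Definition _ := isKernel.Build _ _ _ _ _ kernel_reindex
  measurable_kernel_reindex.

(** The total mass of [K w] may be infinite, so the measures are first restricted to [-n, n], where
    they are finite, and n then tends to infinity. *)
Lemma measurable_kernel_xsection (A : set (X * R)) : measurable A ->
  measurable_fun setT (fun x => K (g x) (xsection A x)).
Proof.
move=> mA.
pose I n : set R := `[(- n%:R)%R, n%:R]%classic.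
have mI n : measurable (I n) by exact: measurable_itv.
pose F n (x : X) := mrestr (K (g x)) (mI n) (xsection A x).
have mx x : measurable (xsection A x) by exact: measurable_xsection.
apply: (emeasurable_fun_cvg F).
- move=> n; have [|//] := @measurable_prod_subset_xsection_kernel _ _ _ _ _
    kernel_reindex _ (mI n) _ A mA.
  move=> x; have : K (g x) (I n) < +oo by exact: (nat_valued_lty (Knat _) (mI n) (@subset_refl _ _)).
  move=> h; exists (fine (K (g x) (I n)) + 1)%R => B mB.
  rewrite (@le_lt_trans _ _ (K (g x) (I n)))//.
    by apply: le_measure; rewrite ?inE//; exact: measurableI.
  by rewrite EFinD fineK ?lteDl// ?ge0_fin_numE// lte_fin.
- move=> x _; rewrite (_ : xsection A x = \bigcup_n (xsection A x `&` I n)).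
    apply: nondecreasing_cvg_mu.
    + by move=> n; exact: measurableI.
    + by apply: bigcupT_measurable => n; exact: measurableI.
    + move=> i j ij; apply/subsetPset; apply: setIS; apply: subset_itv;
        by rewrite bnd_simp ?lerN2 ler_nat.
  rewrite -setI_bigcupr (_ : \bigcup_n I n = setT) ?setIT//.
  apply/seteqP; split => // y _; exists (Num.truncn `|y|).+1 => //=.
  by rewrite /I/= in_itv/= -ler_norml ltW// truncnS_gt.
Qed.

Import HBNNSimple.

Lemma measurable_kernel_integral (h : X * R -> \bar R) :
  (forall p, 0 <= h p) -> measurable_fun setT h ->
  measurable_fun setT (fun x => \int[K (g x)]_s h (x, s)).
Proof.
move=> h0 mh; pose k_ := nnsfun_approx measurableT mh.
apply: (@measurable_fun_xsection_integral _ _ _ _ _ h kernel_reindex k_).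
- by move=> a b ab; exact/nd_nnsfun_approx.
- by move=> z; exact/cvg_nnsfun_approx.
- by move=> n r; exact: measurable_kernel_xsection.
Qed.

End Reindex.

(** Two exchanges: for fixed w between [K w] and Lebesgue measure, then between [P] and Lebesgue
    measure. *)
Lemma campbell_tonelli (P : {sigma_finite_measure set T -> \bar R})
    (h : (T * R) * R -> \bar R) :
  (forall p, 0 <= h p) -> measurable_fun setT h ->
  \int[P]_w \int[K w]_s \int[lebesgue_measure]_t h (w, s, t) =
  \int[lebesgue_measure]_t \int[P]_w \int[K w]_s h (w, s, t).
Proof.
move=> h0 mh.
rewrite -(@fubini_tonelli _ _ _ _ _ P (@lebesgue_measure R)
  (fun p => \int[K p.1]_s h (p.1, s, p.2)))/=.
- apply: eq_integral => w _.
  rewrite (@nat_valued_tonelli _ _ (measurableTypeR R) (@lebesgue_measure R) _ (fun p => h (w, p.1, p.2)))//.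
  apply: measurableT_comp mh _.
  apply: measurable_fun_pair; last exact: measurable_snd.
  by apply: measurable_fun_pair; [exact: measurable_cst|exact: measurable_fst].
- apply: (@measurable_kernel_integral _ _ fst measurable_fst
    (fun p => h (p.1.1, p.2, p.1.2))) => //.
  apply: measurableT_comp mh _.
  apply: measurable_fun_pair.
    apply: measurable_fun_pair => //.
    exact: measurableT_comp.
  exact: measurableT_comp.
- by move=> p; exact: integral_ge0.
Qed.

End KernelMeasurability.

(** * Last and next points as random variables *)

Section PointMeasurability.
Context {R : realType}.
Implicit Types (m : {measure set R -> \bar R}) (r t : R).

(** A rational between the last point and t turns the event into a countable union of conditions on
    masses of intervals that end strictly before t. The strictness is what makes the last point
    predictable. *)
Lemma last_before_gt m r t : nat_valued m -> (r%:E < last_before m t) <->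
  exists q : rat, (ratr q < t)%R /\ 0 < m `]r, ratr q]%classic.
Proof.
move=> mnat; split.
  case: last_beforeP => // x xt mx _; rewrite lte_fin => rx.
  have [q] := rat_in_itvoo xt; rewrite in_itv/= => /andP[xq qt].
  exists q; split => //; apply: lt_le_trans mx _; apply: le_measure; rewrite ?inE//.
  by move=> _ ->; rewrite /= in_itv/= rx ltW.
move=> [q [qt mq]]; rewrite ltNge; apply/negP => h; move: mq.
rewrite (_ : m _ = 0) ?ltxx//.
case: last_beforeP h => // [m0 _|x xt mx m0]; last rewrite lee_fin => xr.
  apply: measure_null_le m0 => // y; rewrite /= !in_itv/= => /andP[_ yq].
  exact: le_lt_trans qt.
apply: measure_null_le m0 => // y; rewrite /= !in_itv/= => /andP[ry yq].
by rewrite (le_lt_trans xr)//= (le_lt_trans yq).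
Qed.

(** Two rationals are used because t will be random: it may not bound the interval whose mass is
    tested. The second one, below r, keeps the inequality strict. *)
Lemma next_after_lt m r t : nat_valued m -> (next_after m t < r%:E) <->
  exists q q' : rat, [/\ (t < ratr q)%R, (ratr q' < r)%R &
    0 < m `]ratr q, ratr q']%classic].
Proof.
move=> mnat; split.
  case: next_afterP => // x tx mx _; rewrite lte_fin => xr.
  have [q] := rat_in_itvoo tx; rewrite in_itv/= => /andP[tq qx].
  have [q'] := rat_in_itvoo xr; rewrite in_itv/= => /andP[xq' q'r].
  exists q, q'; split => //; apply: lt_le_trans mx _.
  apply: le_measure; rewrite ?inE//.
  by move=> _ ->; rewrite /= in_itv/= qx ltW.
move=> [q [q' [tq q'r mq]]]; rewrite ltNge; apply/negP => h; move: mq.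
rewrite (_ : m _ = 0) ?ltxx//.
case: next_afterP h => // [m0 _|x xt mx m0]; last rewrite lee_fin => rx.
  apply: measure_null_le m0 => // y; rewrite /= !in_itv/= andbT => /andP[qy _].
  exact: lt_trans qy.
apply: measure_null_le m0 => // y; rewrite /= !in_itv/= => /andP[qy yq'].
by rewrite (lt_trans tq)//= (le_lt_trans yq')// (lt_le_trans q'r).
Qed.

Lemma last_upto_gt m r t : nat_valued m -> (r%:E < last_upto m t) <->
  0 < m `]r, t]%classic.
Proof.
move=> mnat; split.
  move=> /ereal_sup_gt[_ [s [st ms] <-]]; rewrite lte_fin => rs.
  apply: lt_le_trans ms _; apply: le_measure; rewrite ?inE//.
  by move=> _ ->; rewrite /= in_itv/= rs.
have [tr|rt] := leP t r.
  by rewrite set_itv_ge ?measure0 ?ltxx// bnd_simp -leNgt.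
move=> mrt; have [mt|mt] := ltP 0 (m [set t]).
  by rewrite last_upto_atom// lte_fin.
have {}mt : m [set t] = 0 by apply/eqP; rewrite eq_le measure_ge0 mt.
rewrite ltNge; apply/negP => h; move: mrt.
rewrite (_ : m _ = 0) ?ltxx//.
rewrite -(@setUitv1 _ _ _ _ true) ?bnd_simp//; apply: measureU_eq0 => //.
apply: no_atoms_itv => // s /andP[rs st]; apply/eqP/negPn/negP => ms.
have : s%:E <= last_upto m t.
  by apply: ereal_sup_ubound; exists s => //; split; [exact: ltW|rewrite lt0e ms measure_ge0].
by move/le_trans/(_ h); rewrite lee_fin leNgt rs.
Qed.

Context {d : measure_display} {X : measurableType d}.
Variables (mu : X -> {measure set R -> \bar R}).
Hypothesis munat : forall x, nat_valued (mu x).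

(** Measurability is asked only of the mass of ]a, b] on {b < tau}. For the predictable
    sigma-algebra this is the right requirement: that mass is known only from time b on. *)
Lemma measurable_last_before (tau : X -> R) :
  (forall a b : R, measurable [set x | (b < tau x)%R /\ 0 < mu x `]a, b]%classic]) ->
  measurable_fun setT (fun x => last_before (mu x) (tau x)).
Proof.
move=> H; apply: (measurability _ (ErealGenOInfty.measurableE R)).
move=> _ [_ [r ->] <-]; rewrite setTI.
rewrite (_ : _ @^-1` _ = \bigcup_(q : rat)
    [set x | (ratr q < tau x)%R /\ 0 < mu x `]r, ratr q]%classic]).
  by apply: bigcupT_measurable_rat => q; exact: H.
apply/seteqP; split => x /=; rewrite in_itv/= andbT.
  by move=> /(last_before_gt _ _ (munat x))[q h]; exists q.
by move=> [q _ h]; apply/(last_before_gt _ _ (munat x)); exists q.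
Qed.

Lemma measurable_next_after (tau : X -> R) :
  (forall a b : R, measurable [set x | (tau x < a)%R /\ 0 < mu x `]a, b]%classic]) ->
  measurable_fun setT (fun x => next_after (mu x) (tau x)).
Proof.
move=> H; apply: (measurability _ (ErealGenInftyO.measurableE R)).
move=> _ [_ [r ->] <-]; rewrite setTI.
rewrite (_ : _ @^-1` _ = \bigcup_(q : rat) \bigcup_(q' : rat)
    ((if (ratr q' < r)%R then setT else set0) `&`
    [set x | (tau x < ratr q)%R /\ 0 < mu x `]ratr q, ratr q']%classic])).
  apply: bigcupT_measurable_rat => q; apply: bigcupT_measurable_rat => q'.
  by apply: measurableI; [case: ifP|exact: H].
apply/seteqP; split => x /=; rewrite in_itv/=.
  move=> /(next_after_lt _ _ (munat x))[q [q' [h1 h2 h3]]].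
  by exists q => //; exists q' => //; rewrite h2.
move=> [q _ [q' _ [+ [h2 h3]]]].
case: ifPn => // h1 _; apply/(next_after_lt _ _ (munat x)).
by exists q, q'.
Qed.

Hypothesis mmu : forall B, measurable B -> measurable_fun setT (mu ^~ B).

Lemma measurable_pos_mass (B : set R) : measurable B ->
  measurable [set x | 0 < mu x B].
Proof.
move=> mB; rewrite -[X in measurable X]setTI.
have := mmu mB; move=> /emeasurable_fun_o_infty; exact.
Qed.

Lemma measurable_last_upto t :
  measurable_fun setT (fun x => last_upto (mu x) t).
Proof.
apply: (measurability _ (ErealGenOInfty.measurableE R)).
move=> _ [_ [r ->] <-]; rewrite setTI.
rewrite (_ : _ @^-1` _ = [set x | 0 < mu x `]r, t]%classic]).
  exact: measurable_pos_mass.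
apply/seteqP; split => x /=; rewrite in_itv/= andbT.
  by move=> /(last_upto_gt _ _ (munat x)).
by move=> h; apply/(last_upto_gt _ _ (munat x)).
Qed.

Lemma measurable_last_before_comp (tau : X -> R) : measurable_fun setT tau ->
  measurable_fun setT (fun x => last_before (mu x) (tau x)).
Proof.
move=> mtau; apply: measurable_last_before => a b.
apply: measurableI; last exact: measurable_pos_mass.
rewrite -[X in measurable X]setTI.
by have := mtau measurableT _ (measurable_itv `]b, +oo[);
  rewrite set_itvE.
Qed.

Lemma measurable_next_after_comp (tau : X -> R) : measurable_fun setT tau ->
  measurable_fun setT (fun x => next_after (mu x) (tau x)).
Proof.
move=> mtau; apply: measurable_next_after => a b.
apply: measurableI; last exact: measurable_pos_mass.
rewrite -[X in measurable X]setTI.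
by have := mtau measurableT _ (measurable_itv `]-oo, a[);
  rewrite set_itvE.
Qed.

Lemma measurable_back k : measurable_fun setT (fun x => back (mu x) k).
Proof.
elim: k => [|k IHk] /=.
  by apply: measurableT_comp (measurable_last_upto 0%R); exact: fine_measurable.
apply: (measurableT_comp (fine_measurable measurableT)).
exact: measurable_last_before_comp IHk.
Qed.

Lemma measurable_past k : measurable_fun setT (fun x => past (mu x) k).
Proof.
under eq_fun do rewrite past_back.
by apply: measurable_funB; exact: measurable_back.
Qed.

Lemma measurable_inter_arrival0 :
  measurable_fun setT (fun x => inter_arrival (mu x) 0).
Proof.
apply: measurable_funB; last exact: (measurable_back 0).
apply: (measurableT_comp (fine_measurable measurableT)).
exact: measurable_next_after_comp (measurable_back 0).
Qed.

End PointMeasurability.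

(** * Mecke's formula and the Palm mass *)

Lemma point_process_nat d (Omega : measurableType d) (R : realType)
    (K : R.-ker Omega ~> R) w : point_process K -> nat_valued (K w).
Proof. by move=> Kpp a b B mB Bab; exact: Kpp mB Bab. Qed.

Section Campbell.
Context {d : measure_display} {Omega : measurableType d} {R : realType}.
Variables (P : {measure set Omega -> \bar R}) (K : R.-ker Omega ~> R).
Hypothesis Knat : forall w, nat_valued (K w).

Definition campbell (E : set (R * Omega)) : \bar R :=
  \int[P]_w K w (ysection E w).

Lemma measurable_campbell_integrand (E : set (R * Omega)) : measurable E ->
  measurable_fun setT (fun w => K w (ysection E w)).
Proof.
move=> mE; pose E' : set (Omega * R) := [set p | E (p.2, p.1)].
have mE' : measurable E'.
  have mswap : measurable_fun setT (fun p : Omega * R => (p.2, p.1)).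
    by apply: measurable_fun_pair; [exact: measurable_snd|exact: measurable_fst].
  by rewrite -[X in measurable X]setTI; exact: mswap.
have := @measurable_kernel_xsection _ _ _ K Knat _ _ id (@measurable_id _ _ _) E' mE'.
congr (measurable_fun _ _); apply/funext => w; congr (K w _).
Qed.

Lemma campbell0 : campbell set0 = 0.
Proof. by rewrite /campbell integral0_eq// => w _; rewrite ysection0 measure0. Qed.

Let campbell_ge0 E : 0 <= campbell E.
Proof. by apply: integral_ge0. Qed.

Lemma campbell_sigma_additive : semi_sigma_additive campbell.
Proof.
move=> F mF tF mUF; apply/cvg_closeP; split.
  by apply: is_cvg_nneseries => n _ _; exact: campbell_ge0.
rewrite closeE// -integral_nneseries//; last first.
  by move=> n; exact: measurable_campbell_integrand.
apply: eq_integral => w _; rewrite ysection_bigcup measure_semi_bigcup//.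
- by move=> n; exact: measurable_ysection.
- exact: trivIset_ysection.
- by apply: bigcupT_measurable => n; exact: measurable_ysection.
Qed.

HB.instance Definition _ := isMeasure.Build _ _ _ campbell
  campbell0 campbell_ge0 campbell_sigma_additive.

Definition campbell_measure : {measure set (R * Omega) -> \bar R} := campbell.

End Campbell.

Section Palm.
Context {d : measure_display} {Omega : measurableType d} {R : realType}.
Variables (P : probability Omega R) (theta : R -> Omega -> Omega).
Hypothesis flow : measurable_flow theta.
Hypothesis invP : flow_preserves P theta.

Lemma flowD s t w : theta (s + t)%R w = theta s (theta t w).
Proof. by case: flow. Qed.

Lemma flowNK t w : theta (- t)%R (theta t w) = w.
Proof. by case: flow => _ h0 hD; rewrite -hD addNr h0. Qed.

Lemma measurable_flow_comp d' (X : measurableType d') (f : X -> R)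
    (g : X -> Omega) : measurable_fun setT f -> measurable_fun setT g ->
  measurable_fun setT (fun x => theta (f x) (g x)).
Proof.
move=> mf mg; have [mth _ _] := flow.
exact: (measurableT_comp mth (measurable_fun_pair mf mg)).
Qed.

Lemma measurable_flow_at t : measurable_fun setT (theta t).
Proof.
apply: (@measurable_flow_comp _ _ (fun=> t) id); first exact: measurable_cst.
exact: measurable_id.
Qed.

Lemma expectation_flow (g : Omega -> \bar R) t : (forall w, 0 <= g w) ->
  measurable_fun setT g -> \int[P]_w g (theta t w) = \int[P]_w g w.
Proof.
move=> g0 mg; transitivity (\int[pushforward P (theta t)]_w g w).
  by rewrite ge0_integral_pushforward//; exact: measurable_flow_at.
apply: eq_measure_integral => [|? A mA _]; first exact: measurable_flow_at.
exact: invP.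
Qed.

Variable K : R.-ker Omega ~> R.
Hypothesis Kpp : point_process K.
Hypothesis Kc : flow_compatible theta K.
Let Knat w : nat_valued (K w). Proof. exact: point_process_nat. Qed.

Lemma kernel_flow t w (B : set R) : measurable B ->
  K (theta t w) B = K w [set s | B (s - t)%R].
Proof.
move=> mB; rewrite Kc//; congr (K w _); apply/seteqP; split => x.
  by move=> [y By <-] /=; rewrite addrK.
by move=> /= Bx; exists (x - t)%R => //; rewrite subrK.
Qed.

Lemma kernel_integral_flow t w (h : R -> \bar R) : (forall s, 0 <= h s) ->
  measurable_fun setT h ->
  \int[K (theta t w)]_s h s = \int[K w]_s h (s - t)%R.
Proof.
move=> h0 mh; have mt : measurable_fun setT (fun s : R => s - t)%R.
  exact: measurable_funB.
transitivity (\int[pushforward (K w) (fun s : R => s - t)%R]_s h s); last first.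
  by rewrite ge0_integral_pushforward.
by apply: eq_measure_integral => A mA _; exact: kernel_flow.
Qed.

Let win (s : R) : \bar R := (\1_(`]0%R, 1%R]%classic) s)%:E.

Let I0 s : 0 <= win s. Proof. by rewrite lee_fin. Qed.

Let mI : measurable_fun setT win.
Proof. by apply/measurable_EFinP; exact: measurable_indic. Qed.

Let mIcomp d' (X : measurableType d') (f : X -> R) :
  measurable_fun setT f -> measurable_fun setT (fun x => win (f x)).
Proof. by move=> mf; exact: measurableT_comp mI mf. Qed.

Lemma integral_unit_window s : \int[lebesgue_measure]_t win (s + t)%R = 1.
Proof.
transitivity (\int[lebesgue_measure]_t win t); last first.
  by rewrite integral_indic//= setIT lebesgue_measure_itv/= lte_fin ltr01 oppr0 adde0.
by rewrite -(ge0_integral_shift s mI I0); apply: eq_integral => t _; rewrite addrC.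
Qed.

(* Inserting 1 = \int 1_(]0, 1])(s + t) dt and shifting the origin by t trades
   the integral over the location of the point for a Lebesgue integral. *)
Lemma mecke (h : R * Omega -> \bar R) : (forall p, 0 <= h p) ->
  measurable_fun setT h ->
  \int[P]_w \int[K w]_s h (s, theta s w) =
  \int[lebesgue_measure]_s \int[P]_w \int[K w]_t (win t * h (s, theta t w)).
Proof.
move=> h0 mh.
have mhc d' (X : measurableType d') (f f' : X -> R) (g : X -> Omega) :
    measurable_fun setT f -> measurable_fun setT f' -> measurable_fun setT g ->
    measurable_fun setT (fun x => h (f x, theta (f' x) (g x))).
  move=> mf mf' mg; apply: (measurableT_comp mh); apply: measurable_fun_pair => //.
  exact: measurable_flow_comp.
pose X := ((Omega * R) * measurableTypeR R)%type.
have m1 : measurable_fun setT (fun p : X => p.1.1).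
  exact: measurableT_comp measurable_fst measurable_fst.
have m2 : measurable_fun setT (fun p : X => p.1.2).
  exact: measurableT_comp measurable_snd measurable_fst.
have m3 : measurable_fun setT (fun p : X => p.2) by exact: measurable_snd.
rewrite -(@campbell_tonelli _ _ _ K Knat P
  (fun p => win p.1.2 * h (p.2, theta p.1.2 p.1.1)))/=; first last.
- by apply: emeasurable_funM; [exact: mIcomp|exact: mhc].
- by move=> p; rewrite mule_ge0.
transitivity (\int[P]_w \int[K w]_s \int[lebesgue_measure]_t
    (win s * h ((s - t)%R, theta s w))); last first.
  apply: eq_integral => w _; apply: eq_integral => s _.
  apply: (@ge0_integral_reflect _ (fun t => win s * h (t, theta s w))).
    apply: emeasurable_funM; first exact: measurable_cst.
    by apply: mhc; [exact: measurable_id|exact: measurable_cst|exact: measurable_cst].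
  by move=> t; rewrite mule_ge0.
rewrite (@campbell_tonelli _ _ _ K Knat P
  (fun p => win p.1.2 * h ((p.1.2 - p.2)%R, theta p.1.2 p.1.1)))/=; first last.
- apply: emeasurable_funM; [exact: mIcomp|apply: mhc => //].
  exact: measurable_funB.
- by move=> p; rewrite mule_ge0.
transitivity (\int[lebesgue_measure]_t \int[P]_w \int[K w]_s
    (win (s + t)%R * h (s, theta s w))); last first.
  apply: eq_integral => t _.
  pose F w := \int[K w]_s (win s * h ((s - t)%R, theta s w)).
  rewrite -[RHS](@expectation_flow F (- t)%R).
  - apply: eq_integral => w _; rewrite /F kernel_integral_flow.
    + apply: eq_integral => s _; rewrite opprK addrK.
      by rewrite -flowD addrK.
    + by move=> s; rewrite mule_ge0.
    + apply: emeasurable_funM => //.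
      apply: mhc; [exact: measurable_funB|exact: measurable_id|exact: measurable_cst].
  - by move=> w; apply: integral_ge0 => s _; rewrite mule_ge0.
  - rewrite /F; apply: (@measurable_kernel_integral _ _ _ K Knat _ _ id (@measurable_id _ _ _)
      (fun p => win p.2 * h ((p.2 - t)%R, theta p.2 p.1))).
      by move=> p; rewrite mule_ge0.
    apply: emeasurable_funM; first by apply: mIcomp; exact: measurable_snd.
    apply: mhc; [|exact: measurable_snd|exact: measurable_fst].
    apply: measurable_funB; [exact: measurable_snd|exact: measurable_cst].
rewrite -(@campbell_tonelli _ _ _ K Knat P
  (fun p => win (p.1.2 + p.2)%R * h (p.1.2, theta p.1.2 p.1.1)))/=; first last.
- apply: emeasurable_funM; [apply: mIcomp|exact: mhc].
  exact: measurable_funD.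
- by move=> p; rewrite mule_ge0.
apply: eq_integral => w _; apply: eq_integral => s _.
rewrite ge0_integralZr//.
- by rewrite integral_unit_window mul1e.
- apply: mIcomp; apply: measurable_funD; [exact: measurable_cst|exact: measurable_id].
Qed.

(** The Palm probability times the intensity, with the inner integral of [palm] already
    evaluated. *)
Definition palm_mass (A : set Omega) : \bar R :=
  \int[P]_w K w (`]0%R, 1%R]%classic `&` [set s | A (theta s w)]).

Lemma measurable_flow_section w (A : set Omega) : measurable A ->
  measurable [set s | A (theta s w)].
Proof.
move=> mA; rewrite -[X in measurable X]setTI.
apply: (@measurable_flow_comp _ R id (cst w)) => //; exact: measurable_cst.
Qed.

(** The Palm mass is the Campbell measure of this set, from which it inherits sigma-additivity. *)
Definition palm_window (A : set Omega) : set (R * Omega) :=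
  [set p | `]0%R, 1%R]%classic p.1 /\ A (theta p.1 p.2)].

Lemma palm_mass_campbell A : palm_mass A = campbell P K (palm_window A).
Proof.
apply: eq_integral => w _; congr (K w _).
by apply/seteqP; split => s; rewrite /ysection/= ?inE.
Qed.

Lemma measurable_palm_window A : measurable A -> measurable (palm_window A).
Proof.
move=> mA; have mth : measurable_fun setT (fun p : R * Omega => theta p.1 p.2).
  exact: (@measurable_flow_comp _ _ fst snd measurable_fst measurable_snd).
have mfst := @measurable_fst _ _ R Omega.
by apply: measurableI; rewrite -[X in measurable X]setTI;
  [exact: mfst|exact: mth].
Qed.

Lemma measurable_palm_integrand (A : set Omega) : measurable A ->
  measurable_fun setT
    (fun w => K w (`]0%R, 1%R]%classic `&` [set s | A (theta s w)])).
Proof.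
move=> mA; have := measurable_campbell_integrand Knat (measurable_palm_window mA).
congr (measurable_fun _ _); apply/funext => w; congr (K w _).
by apply/seteqP; split => s; rewrite /ysection /= ?inE.
Qed.

Let palm_mass0 : palm_mass set0 = 0.
Proof.
rewrite palm_mass_campbell (_ : palm_window _ = set0).
  exact: campbell0.
by apply/seteqP; split => // p [].
Qed.

Let palm_mass_ge0 A : 0 <= palm_mass A.
Proof. by apply: integral_ge0. Qed.

Let palm_mass_sigma_additive : semi_sigma_additive palm_mass.
Proof.
move=> F mF tF mUF; under eq_fun do under eq_bigr do rewrite palm_mass_campbell.
rewrite palm_mass_campbell (_ : palm_window _ = \bigcup_n palm_window (F n)).
  apply: (campbell_sigma_additive Knat).
  - by move=> n; exact: measurable_palm_window.
  - apply/trivIsetP => i j _ _ ij; move/trivIsetP : tF => /(_ i j I I ij) Fij.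
    apply/seteqP; split => // p [[_ Fi] [_ Fj]].
    by have : (F i `&` F j) (theta p.1 p.2) by []; rewrite Fij.
  - by apply: bigcupT_measurable => n; exact: measurable_palm_window.
apply/seteqP; split => [p [wp [n _ Fn]]|p [n _ [wp Fn]]]; first by exists n.
by split => //; exists n.
Qed.

HB.instance Definition _ := isMeasure.Build _ _ _ palm_mass
  palm_mass0 palm_mass_ge0 palm_mass_sigma_additive.

Lemma palm_massT : palm_mass setT = intensity P K.
Proof. by apply: eq_integral => w _; rewrite setIT. Qed.

Lemma palm_massE (A : set Omega) : measurable A ->
  palm P theta K A = ((fine (intensity P K))^-1)%:E * palm_mass A.
Proof.
move=> mA; rewrite /palm; congr (_ * _); apply: eq_integral => w _.
rewrite (_ : (fun s => _) = (fun s => (\1_[set s | A (theta s w)] s)%:E))//.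
rewrite integral_indic//; last exact: measurable_flow_section.
by rewrite setIC.
Qed.

(** The form used on both sides of the intensity identity: [c] is the indicator of ]a, b] when
    points are counted, and the hazard as a function of the location of the last point otherwise. *)
Lemma mecke_indic (c : R -> R) (D : set (R * Omega)) :
  (forall s, (0 <= c s)%R) -> measurable_fun setT c -> measurable D ->
  \int[P]_w \int[K w]_s ((c s)%:E * (\1_D (s, theta s w))%:E) =
  \int[lebesgue_measure]_s ((c s)%:E * palm_mass (xsection D s)).
Proof.
move=> c0 mc mD.
rewrite (mecke (h := fun p => (c p.1)%:E * (\1_D p)%:E))/=; first last.
- apply: emeasurable_funM.
    by apply/measurable_EFinP; exact: measurableT_comp mc measurable_fst.
  by apply/measurable_EFinP; exact: measurable_indic.
- by move=> p; rewrite mule_ge0// lee_fin.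
apply: eq_integral => s _.
rewrite /palm_mass -ge0_integralZl//; first last.
- by rewrite lee_fin.
- apply: measurable_palm_integrand; exact: measurable_xsection.
apply: eq_integral => w _.
under eq_integral do rewrite muleCA.
have mG : measurable [set t | D (s, theta t w)].
  have := measurable_flow_section w (measurable_xsection s mD).
  by congr measurable; apply/seteqP; split => t; rewrite /xsection/= inE.
rewrite ge0_integralZl//; first last.
- by rewrite lee_fin.
- by move=> t _; rewrite mule_ge0// lee_fin.
- apply: emeasurable_funM => //; apply/measurable_EFinP.
  exact: (measurable_indic mG).
congr (_ * _).
rewrite (_ : (fun t => _) = (fun t => (\1_(`]0%R, 1%R]%classic `&`
   [set t | D (s, theta t w)]) t)%:E)).
  rewrite integral_indic//; last by apply: measurableI.
  rewrite setIT; congr (K w _); apply/seteqP; split => t [? ?]; split => //;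
    by rewrite /xsection/= ?inE// -inE.
apply/funext => t; rewrite /win indicI /= EFinM; congr (_ * _).
Qed.

(** One exceptional event must serve all times s, because a P-null event may have full Palm mass,
    like the presence of a point at 0. *)
Lemma palm_mass_ae0 (B : set Omega) : measurable B ->
  {ae P, forall w, forall s, ~ B (theta s w)} -> palm_mass B = 0.
Proof.
move=> mB aeB; rewrite /palm_mass -(@integral0 _ _ _ P setT).
apply: ae_eq_integral => //; first exact: measurable_palm_integrand.
apply: filterS aeB => w Bw _.
rewrite (_ : _ `&` _ = set0) ?measure0//.
by apply/seteqP; split => // s [_ /Bw].
Qed.

(** The finite intensity is an argument so that the finite-measure structure can be attached. *)
Definition palm_finite (_ : intensity P K < +oo) : set Omega -> \bar R :=
  palm_mass.

HB.instance Definition _ h := Measure.copy (palm_finite h) palm_mass.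

Let palm_finite_fin h : fin_num_fun (palm_finite h).
Proof. by apply: lty_fin_num_fun; apply: (le_lt_trans _ h); rewrite -palm_massT. Qed.

HB.instance Definition _ h := Measure_isFinite.Build _ _ _ (palm_finite h)
  (palm_finite_fin h).

Definition palm_measure (h : intensity P K < +oo) :
  {finite_measure set Omega -> \bar R} := palm_finite h.

End Palm.

(** * Laws of sequences and histories *)

Section ImageMeasure.
Context {d d' : measure_display} {T : measurableType d} {T' : measurableType d'}
  {R : realType}.
Variables (mu : {measure set T -> \bar R}) (g : T -> T').

Definition image_measure (_ : measurable_fun setT g) : set T' -> \bar R :=
  fun A => mu (g @^-1` A).

Variable mg : measurable_fun setT g.

Let image_measure0 : image_measure mg set0 = 0.
Proof. by rewrite /image_measure preimage_set0 measure0. Qed.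

Let image_measure_ge0 A : 0 <= image_measure mg A.
Proof. by []. Qed.

Let image_measure_sigma_additive : semi_sigma_additive (image_measure mg).
Proof.
move=> A mA tA mUA.
by have := @measure_semi_sigma_additive _ _ _ (pushforward mu g); apply.
Qed.

HB.instance Definition _ := isMeasure.Build _ _ _ (image_measure mg)
  image_measure0 image_measure_ge0 image_measure_sigma_additive.

Lemma ge0_integral_image (h : T' -> \bar R) : measurable_fun setT h ->
  (forall y, 0 <= h y) -> \int[image_measure mg]_y h y = \int[mu]_x h (g x).
Proof. by move=> mh h0; rewrite ge0_integral_pushforward. Qed.

End ImageMeasure.

Section Weighted.
Context {d : measure_display} {T : measurableType d} {R : realType}.
Variables (mu : {measure set T -> \bar R}) (g : T -> \bar R).

Definition weighted (mg : measurable_fun setT g) (g0 : forall x, 0 <= g x) :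
  set T -> \bar R := fun A => \int[mu]_(x in A) g x.

Variables (mg : measurable_fun setT g) (g0 : forall x, 0 <= g x).

Let weighted0 : weighted mg g0 set0 = 0.
Proof. exact: integral_set0. Qed.

Let weighted_ge0 A : 0 <= weighted mg g0 A.
Proof. exact: integral_ge0. Qed.

Let weighted_sigma_additive : semi_sigma_additive (weighted mg g0).
Proof. exact: semi_sigma_additive_nng_induced. Qed.

HB.instance Definition _ := isMeasure.Build _ _ _ (weighted mg g0)
  weighted0 weighted_ge0 weighted_sigma_additive.

End Weighted.

(** * Laws on the line with a density: survival function and zeros of 1 - F *)

Section DensityLaw.
Context {R : realType}.
Variables (nu : {measure set R -> \bar R}) (F f : R -> R).
Hypothesis nuF : forall t, nu `]-oo, t]%classic = (F t)%:E.
Hypothesis nu1 : nu setT = 1.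
Hypothesis dF : is_density F f.

Lemma density_law (B : set R) : measurable B ->
  nu B = \int[lebesgue_measure]_(x in B) (f x)%:E.
Proof.
move=> mB; have [mf f0 Ff] := dF.
have mfE : measurable_fun (setT : set (measurableTypeR R)) (EFin \o f).
  exact/measurable_EFinP.
have fE0 x : 0 <= (f x)%:E by rewrite lee_fin.
(* Lebesgue measure lives on [measurableTypeR R], generated by the half-open intervals; the identity
   carries [nu] there, where the two measures can be compared. *)
have mid : measurable_fun setT (id : R -> measurableTypeR R) by exact: measurable_id.
pose nu' := image_measure nu mid.
pose mm := weighted (@lebesgue_measure R) mfE fE0.
apply: (@measure_unique _ _ (measurableTypeR R) (@ocitv R)
  (fun k => `](- k%:R)%R, k%:R]%classic) _ _ _ _ nu' mm).
- by [].
- exact: ocitvI.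
- by move=> k; exists ((- k%:R)%R, k%:R).
- apply/seteqP; split => // x _; exists (Num.truncn `|x|).+1 => //=.
  have : (`|x| < (Num.truncn `|x|).+1%:R)%R by exact: truncnS_gt.
  by rewrite ltr_norml in_itv/= => /andP[-> /ltW].
- move=> _ [[a b]] _ <- /=; rewrite /nu' /image_measure /mm /weighted /= preimage_id.
  have [ba|ab] := leP b a.
    by rewrite set_itv_ge ?measure0 ?integral_set0// bnd_simp -leNgt.
  have disj : [disjoint `]-oo, a]%classic & `]a, b]%classic].
    apply/disj_setPS => x [/=]; rewrite !in_itv/= => xa /andP[ax _].
    by rewrite leNgt ax in xa.
  have split : `]-oo, b]%classic = `]-oo, a]%classic `|` `]a, b]%classic.
    by rewrite -itv_bndbnd_setU// bnd_simp ltW.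
  have Ea := Ff a; have := Ff b; rewrite split ge0_integral_setU//; last first.
    exact: measurable_funTS.
  rewrite -Ea -!nuF split measureU//; last exact/disj_set2P.
  move=> h0; have h : nu `]-oo, a]%classic + nu `]a, b]%classic = _ := h0.
  have fina : nu `]-oo, a]%classic \is a fin_num by rewrite nuF.
  have := congr1 (fun z => z - nu `]-oo, a]%classic) h.
  by rewrite /= ![nu `]-oo, a]%classic + _]addeC !addeK.
- move=> k; change (nu `](- k%:R)%R, k%:R]%classic < +oo).
  apply: (@le_lt_trans _ _ (nu setT)); last by rewrite nu1 ltry.
  by apply: le_measure; rewrite ?inE.
- by [].
Qed.

Lemma density_law_set1 x : nu [set x] = 0.
Proof. by rewrite density_law// integral_set1. Qed.

(** A law with a density has no atom, so the closed half-line already gives the denominator of the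
    hazard rate. *)
Lemma density_ccdf u : nu `[u, +oo[%classic = (1 - F u)%:E.
Proof.
have : nu setT = nu `]-oo, u]%classic + nu `]u, +oo[%classic.
  rewrite -measureU//; first by rewrite -itv_bndbnd_setU// set_itvE.
  apply/seteqP; split => // x [/=]; rewrite !in_itv/= andbT => xu.
  by rewrite ltNge xu.
rewrite nu1 nuF => h.
rewrite -(@setU1itv _ _ _ _ false)// setUC measureU0//; last exact: density_law_set1.
by rewrite EFinB [X in X - _]h addeAC subee// add0e.
Qed.

Lemma cdf_nondecreasing_of_law : {homo F : x y / (x <= y)%R}.
Proof.
move=> x y xy; rewrite -lee_fin -!nuF le_measure ?inE//.
by apply: subset_itvl; rewrite bnd_simp.
Qed.

Lemma measurable_cdf_of_law : measurable_fun setT F.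
Proof.
apply: nondecreasing_measurable => // x y; exact: cdf_nondecreasing_of_law.
Qed.

Lemma cdf_le1_of_law u : (F u <= 1)%R.
Proof. by rewrite -lee_fin -nuF -nu1 le_measure ?inE. Qed.

(** On this set the hazard rate divides by 0. The set is closed upwards and [u, +oo[ is null for
    each of its elements u; the half-lines with a rational left end cover it up to its least
    element, which is not an atom. *)
Lemma density_cdf_null : nu [set u | F u = 1%R] = 0.
Proof.
pose U := [set u | F u = 1%R].
have mU : measurable U.
  rewrite (_ : U = F @^-1` [set 1%R])// -[X in measurable X]setTI.
  by apply: measurable_cdf_of_law => //; exact: measurable_set1.
have U0 u : U u -> nu `[u, +oo[%classic = 0.
  by move=> /= Fu; rewrite density_ccdf Fu subrr.
have Uup u v : U u -> (u <= v)%R -> U v.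
  move=> Uu uv; apply/eqP; rewrite eq_le cdf_le1_of_law -Uu.
  exact: cdf_nondecreasing_of_law.
pose q n : R := ratr (odflt (0%R : rat) (unpickle n)).
pose N := \bigcup_n (if F (q n) == 1%R then `[q n, +oo[%classic else set0).
have mN : measurable N.
  by apply: bigcupT_measurable => n; case: ifP.
have N0 : nu N = 0.
  apply: bigcup_measure0 => n; first by case: ifP.
  by case: ifPn => [/eqP/U0//|_]; rewrite measure0.
have UN u v : U u -> (u < v)%R -> N v.
  move=> Uu uv; have [r] := rat_in_itvoo uv; rewrite in_itv/= => /andP[ur rv].
  exists (pickle r) => //; rewrite /q pickleK/= ifT ?in_itv/= ?ltW//.
  by rewrite in_itv/= ltW.
  by apply/eqP; apply: (Uup u) => //; exact: ltW.
have [h|/existsNP[u0 /not_implyP[Uu0 Nu0]]] := pselect (forall u, U u -> N u).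
  exact: measure_null_le N0.
apply: (@measure_null_le _ _ _ nu U (N `|` [set u0])) => //.
- exact: measurableU.
- move=> u Uu; have [uu0|u0u|->] := ltgtP u u0; last by right.
    by exfalso; exact/Nu0/(UN u).
  by left; exact: UN Uu0 u0u.
- by apply: measureU_eq0 => //; exact: density_law_set1.
Qed.

End DensityLaw.

(** * The product sigma-algebra on sequences of intervals *)

Section Sequences.
Context {R : realType}.

(** With k <= n rather than k < n, every cylinder has a constraint on coordinate 0, which can then
    be split off from the others. *)
Definition cylinder : set (set (nat -> R)) := [set C | exists D n,
  (forall k, measurable (D k)) /\ C = [set x | forall k, (k <= n)%N -> D k (x k)]].

Definition rseq := g_sigma_algebraType cylinder.

Lemma cylinderI : setI_closed cylinder.
Proof.
move=> _ _ [D [n [mD ->]]] [D' [n' [mD' ->]]].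
exists (fun k => (if (k <= n)%N then D k else setT) `&`
  (if (k <= n')%N then D' k else setT)), (maxn n n'); split.
  by move=> k; apply: measurableI; case: ifP.
apply/seteqP; split => x /=.
  by move=> [H H'] k _; split; case: ifPn => //; [exact: H|exact: H'].
move=> H; split => k kn.
  by have [] := H k (leq_trans kn (leq_maxl _ _)); rewrite kn.
by have [_] := H k (leq_trans kn (leq_maxr _ _)); rewrite kn.
Qed.

Lemma measurable_coord k : measurable_fun setT (fun x : rseq => x k).
Proof.
move=> _ B mB; rewrite setTI; apply: sub_sigma_algebra.
exists (fun j => if j == k then B else setT), k; split.
  by move=> j; case: ifP.
apply/seteqP; split => x /=; first by move=> Bx j _; case: eqP => // ->.
by move=> /(_ k (leqnn k)); rewrite eqxx.
Qed.

Lemma measurable_to_rseq d (X : measurableType d) (g : X -> rseq) :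
  (forall k, measurable_fun setT (fun x => g x k)) -> measurable_fun setT g.
Proof.
move=> mg; apply: (@measurability _ _ X rseq setT g cylinder erefl) => _ [_ [D [n [mD ->]]] <-].
rewrite setTI (_ : _ @^-1` _ = \big[setI/setT]_(k < n.+1) [set x | D k (g x k)]).
  apply: bigsetI_measurable => k _.
  by rewrite -[X in measurable X]setTI; exact: mg.
rewrite -(bigcap_mkord n.+1 (fun k => [set x | D k (g x k)])); apply/seteqP; split => x /=.
  by move=> H k /=; rewrite ltnS => kn; exact: H.
by move=> H k kn; apply: H; rewrite /= ltnS.
Qed.

Lemma measurable_scons d (X : measurableType d) (u : X -> R) (g : X -> rseq) :
  measurable_fun setT u -> measurable_fun setT g ->
  measurable_fun setT (fun x => scons (u x) (g x) : rseq).
Proof.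
move=> mu mg; apply: measurable_to_rseq => -[//|k].
exact: measurableT_comp (measurable_coord k) mg.
Qed.

Lemma measurable_hits (V : set R) : measurable V ->
  measurable_fun setT (hits V : rseq -> \bar R).
Proof.
move=> mV; apply: ge0_emeasurable_sum; [by move=> *; rewrite lee_fin|move=> k _].
apply/measurable_EFinP.
apply: (measurableT_comp (measurable_indic mV)).
apply: measurable_funN.
by apply: measurable_sum => i; exact: measurable_coord.
Qed.

End Sequences.

Section HistoryRepresentation.
Context {d : measure_display} {Omega : measurableType d} {R : realType}.
Variables (theta : R -> Omega -> Omega) (K : R.-ker Omega ~> R).
Hypothesis Kpp : point_process K.
Hypothesis Kc : flow_compatible theta K.
Let Knat w : nat_valued (K w). Proof. exact: point_process_nat. Qed.

(* Just before its first point after 0, a configuration shifted by u <= T_1 has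
   past inter-arrival times (u, T_0 - T_(-1), T_(-1) - T_(-2), ...). *)
Lemma history_representation (a t : R) (A : set Omega) : (a < t)%R ->
  process_history K a A -> exists2 B : set (rseq (R := R)), measurable B &
  forall w, regular (K w) -> (A (theta (- t)%R w) <-> B (past (K w))) /\
    forall u, (u <= inter_arrival (K w) 0)%R ->
      (A (theta (u - t)%R w) <-> B (scons u (past (K w)))).
Proof.
move=> at_; rewrite /process_history.
set H := [set A : set Omega | exists2 B : set (rseq (R := R)), measurable B &
  forall w, regular (K w) -> (A (theta (- t)%R w) <-> B (past (K w))) /\
    forall u, (u <= inter_arrival (K w) 0)%R ->
      (A (theta (u - t)%R w) <-> B (scons u (past (K w))))].
apply: (@smallest_sub _ _ _ H) => {A}.
  split.
  - exists set0; first exact: measurable0.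
    by move=> w _; split.
  - move=> A [B mB HB]; exists (~` B); first exact: measurableC.
    move=> w wreg; have [HA Hu] := HB w wreg; split.
      by rewrite /= HA; split => [[]|].
    by move=> u /Hu {}Hu; rewrite /= Hu; split => [[]|].
  - move=> A HA; have /choice[B HB] : forall n, exists B : set (rseq (R := R)),
        measurable B /\ forall w, regular (K w) ->
        (A n (theta (- t)%R w) <-> B (past (K w))) /\
        forall u, (u <= inter_arrival (K w) 0)%R ->
        (A n (theta (u - t)%R w) <-> B (scons u (past (K w)))).
      by move=> n; have [B mB HB] := HA n; exists B.
    exists (\bigcup_n B n).
      by apply: bigcupT_measurable => n; case: (HB n).
    move=> w wreg; split.
      split=> -[n _ h]; exists n => //; case: (HB n) => _ /(_ w wreg)[h1 _];
        exact/h1.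
    move=> u uX; split=> -[n _ h]; exists n => //;
      by case: (HB n) => _ /(_ w wreg)[_ /(_ u uX) h1]; exact/h1.
move=> _ [[c e] /= [ce ea] [V mV <-]]; rewrite setTI.
pose W := `](c - t)%R, (e - t)%R]%classic.
have mW : measurable (W : set R) by exact: measurable_itv.
have W0 : W `<=` `]-oo, 0%R[%classic.
  move=> x; rewrite /W /= !in_itv/= => /andP[_ xe].
  by rewrite (le_lt_trans xe)// subr_lt0 (le_lt_trans ea).
exists (hits W @^-1` V).
  by rewrite -[X in measurable X]setTI; exact: measurable_hits.
move=> w wreg; split.
  rewrite /= (kernel_flow Kc)// -(regular_hits (Knat w) wreg mW W0).
  rewrite (_ : [set _ | _] = W)//; apply/seteqP; split => x;
    by rewrite /W /= !in_itv/= opprK ltrBlDr lerBrDr.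
move=> u uX; rewrite /= (kernel_flow Kc)//.
rewrite -(regular_hits_scons (Knat w) wreg mW W0 uX).
rewrite (_ : [set x | `]c, e]%classic _] = [set x | W (x - u)%R])//.
apply/seteqP; split => x; rewrite /W /= !in_itv/=;
  by rewrite (_ : x - (u - t) = x - u + t)%R ?ltrBlDr ?lerBrDr// opprB addrA addrAC.
Qed.

End HistoryRepresentation.

(** * The past of a renewal process under the Palm mass *)

Lemma measurable_lt_set d (T : measurableType d) (R : realType) (f g : T -> R) :
  measurable_fun setT f -> measurable_fun setT g ->
  measurable [set x | (f x < g x)%R].
Proof.
move=> mf mg.
have mh := measurable_funB mg mf.
have := mh measurableT `]0%R, +oo[%classic (measurable_itv _).
rewrite setTI; congr measurable; apply/seteqP; split => x;
  by rewrite /= in_itv/= andbT subr_gt0.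
Qed.

Lemma measurable_invr (R : realType) :
  measurable_fun setT (fun x : R => x^-1%R).
Proof.
rewrite -(setUv [set 0%R]); apply/measurable_funU => //.
  exact: measurableC.
split; first exact: measurable_fun_set1.
apply: open_continuous_measurable_fun.
  by apply: closed_openC; exact: closed_eq.
by move=> x; rewrite inE => x0; apply: inv_continuous; apply/eqP.
Qed.

(** The restriction of m to V is again integer-valued, and has no atoms. *)
Lemma nat_valued_no_atoms (R : realType) (m : {measure set R -> \bar R})
    (a b : R) (V : set R) : nat_valued m -> measurable V ->
  V `<=` `]a, b[%classic -> (forall s, V s -> m [set s] = 0) -> m V = 0.
Proof.
move=> mnat mV Vab V0; have rnat : nat_valued (mrestr m mV).
  move=> x y B mB Bxy; apply: (mnat x y); first exact: measurableI.
  by apply: subset_trans Bxy; exact: subIsetl.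
rewrite -(setIidr Vab); apply: (no_atoms_itv rnat) => s _.
rewrite /= /mrestr; have [Vs|Vs] := pselect (V s).
  rewrite setIidl ?V0//; by move=> _ ->.
by rewrite (_ : _ `&` _ = set0) ?measure0//; apply/seteqP; split => // x [-> /Vs].
Qed.

Section Renewal.
Context {d : measure_display} {Omega : measurableType d} {R : realType}.
Variables (P : probability Omega R) (theta : R -> Omega -> Omega).
Hypothesis flow : measurable_flow theta.
Variable K : R.-ker Omega ~> R.
Hypothesis Kpp : point_process K.
Hypothesis Kc : flow_compatible theta K.
Hypothesis Ksimple : simple_process P K.
Hypothesis Kiid : iid_inter_arrivals P theta K.
Hypothesis Kint : 0 < intensity P K < +oo.
Variable f : R -> R.
Let F := inter_arrival_cdf P theta K.
Hypothesis dF : is_density F f.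

Let Knat w : nat_valued (K w). Proof. exact: point_process_nat. Qed.
Let lam := fine (intensity P K).
Let lamE : intensity P K = lam%:E.
Proof. by case/andP: Kint => ? ?; rewrite fineK// ge0_fin_numE// ltW. Qed.
Let lam0 : (0 < lam)%R.
Proof. by rewrite -lte_fin -lamE; case/andP: Kint. Qed.
Let Klty : intensity P K < +oo. Proof. by case/andP: Kint. Qed.

Let Q : {finite_measure set Omega -> \bar R} := palm_measure flow Kpp Klty.

Let QE A : Q A = palm_mass P theta K A. Proof. by []. Qed.

Let QT : Q setT = lam%:E. Proof. by rewrite QE palm_massT. Qed.

Let palmE A : measurable A -> Q A = lam%:E * palm P theta K A.
Proof.
move=> mA; rewrite (palm_massE P flow K mA) muleA -EFinM divff ?mul1e//.
by rewrite gt_eqF.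
Qed.

Let X0 w := inter_arrival (K w) 0.
Let X w : rseq := past (K w).

Let mX0 : measurable_fun setT X0.
Proof. by apply: measurable_inter_arrival0 => // B mB; exact: measurable_kernel. Qed.

Let mXk k : measurable_fun setT (fun w => X w k).
Proof. by apply: measurable_past => // B mB; exact: measurable_kernel. Qed.

Let mX : measurable_fun setT X.
Proof. exact: measurable_to_rseq. Qed.

Let mpre (B : set R) (h : Omega -> R) : measurable_fun setT h -> measurable B ->
  measurable [set w | B (h w)].
Proof. by move=> mh mB; rewrite -[X in measurable X]setTI; exact: mh. Qed.

Let lamV0 : (0 <= lam^-1)%R. Proof. by rewrite invr_ge0 ltW. Qed.

(** The law of the first inter-arrival time under the Palm probability. *)
Let nu : {measure set R -> \bar R} :=
  mscale (NngNum lamV0) (image_measure Q mX0).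

Let nuE (B : set R) : measurable B ->
  nu B = palm P theta K [set w | B (X0 w)].
Proof.
by move=> mB; rewrite (palm_massE P flow K (mpre mX0 mB)).
Qed.

Let nuT : nu setT = 1.
Proof.
rewrite /nu /= /mscale /= /image_measure preimage_setT QT -EFinM mulVf//.
by rewrite gt_eqF.
Qed.

Let palm_past k (B : set R) : measurable B ->
  palm P theta K [set w | B (X w k)] = nu B.
Proof. move=> mB; rewrite (nuE mB); have [H _] := Kiid.
exact: (H (Negz k) B mB). Qed.

Let Q_past k (B : set R) : measurable B ->
  Q [set w | B (X w k)] = lam%:E * nu B.
Proof. by move=> mB; rewrite (palmE (mpre (mXk k) mB)) palm_past. Qed.

Let Q_X0 (B : set R) : measurable B -> Q [set w | B (X0 w)] = lam%:E * nu B.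
Proof. by move=> mB; rewrite (palmE (mpre mX0 mB)) nuE. Qed.

Let nuF t : nu `]-oo, t]%classic = (F t)%:E.
Proof.
have -> : F t = fine (nu `]-oo, t]%classic).
  by rewrite nuE// /F /inter_arrival_cdf; congr (fine (palm _ _ _ _)).
rewrite fineK// ge0_fin_numE//; apply: (@le_lt_trans _ _ (nu setT)).
  by apply: le_measure; rewrite ?inE.
by rewrite nuT ltry.
Qed.

Let measurable_box (D : nat -> set R) n : (forall k, measurable (D k)) ->
  measurable [set w | forall k, (k < n)%N -> D k (X w k)].
Proof.
move=> mD; rewrite (_ : [set w | _] = \big[setI/setT]_(k < n) [set w | D k (X w k)]).
  by apply: bigsetI_measurable => k _; exact: mpre.
rewrite -(bigcap_mkord n (fun k => [set w | D k (X w k)])).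
by apply/seteqP; split => w H k; exact: H.
Qed.

Let Q_box (D' : set R) (D : nat -> set R) n : measurable D' ->
  (forall k, measurable (D k)) ->
  Q [set w | D' (X0 w) /\ forall k, (k < n)%N -> D k (X w k)] =
  lam%:E * (nu D' * \prod_(k < n) nu (D k)).
Proof.
move=> mD' mD; rewrite palmE; last first.
  by apply: measurableI; [exact: mpre|exact: measurable_box].
congr (_ * _); case: Kiid => _ /(_ (Posz 0 :: [seq Negz k | k <- iota 0 n])
  (fun z => if z is Negz k then D k else D')) H.
transitivity (palm P theta K [set w | forall z : int,
    z \in (Posz 0 :: [seq Negz k | k <- iota 0 n]) ->
    (if z is Negz k then D k else D') (inter_arrival (K w) z)]).
  congr (palm _ _ _ _); apply/seteqP; split => w /=.
    move=> [DX0 DX] z; rewrite inE => /orP[/eqP -> //|/mapP[k]].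
    by rewrite mem_iota add0n => /andP[_ kn] ->; exact: DX.
  move=> Hz; split; first by apply: (Hz (Posz 0)); rewrite inE eqxx.
  move=> k kn; apply: (Hz (Negz k)); rewrite inE; apply/orP; right.
  by apply/mapP; exists k => //; rewrite mem_iota.
rewrite H.
- rewrite big_cons -nuE// big_map -[in X in iota 0 X](subn0 n) big_mkord.
  by congr (_ * _); apply: eq_bigr => k _; exact: palm_past.
- rewrite /= map_inj_uniq ?iota_uniq ?andbT; last by move=> a b [].
  by apply/mapP => -[].
- by case.
Qed.

Let no_origin := [set w | K w [set 0%R] = 0].

Let measurable_no_origin : measurable no_origin.
Proof.
by have := measurable_kernel K _ (measurable_set1 (0%R : R)) measurableT
  _ (emeasurable_set1 0); rewrite setTI.
Qed.

(** If s is an atom of [K w], then the configuration seen from s has a point at 0. The times counted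
    here are therefore never atoms. *)
Let Q_no_origin : Q no_origin = 0.
Proof.
rewrite QE /palm_mass integral0_eq// => w _.
apply: (@nat_valued_no_atoms _ _ (-1)%R 2%R) => //.
- apply: measurableI => //; exact: (measurable_flow_section flow).
- move=> s [+ _]; rewrite /= !in_itv/= => /andP[s0 s1].
  rewrite (lt_trans _ s0) ?ltrN10//= (le_lt_trans s1)// ltr1n//.
- move=> s [_]; rewrite /no_origin /= (kernel_flow Kc)//.
  congr (K w _ = _); apply/seteqP; split => x /=.
    by move=> /eqP; rewrite subr_eq0 => /eqP.
  by move=> ->; rewrite subrr.
Qed.

(** With a point at 0, the interval cannot be negative. The value 0, which [fine] also returns when
    there is no next point, is null because the law has a density. *)
Let nu_le0 : nu `]-oo, 0%R]%classic = 0.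
Proof.
have nu_lt0 : nu `]-oo, 0%R[%classic = 0.
  have : Q [set w | `]-oo, 0%R[%classic (X0 w)] = 0.
    apply: measure_null_le Q_no_origin => //; first exact: mpre.
    move=> w; rewrite /no_origin /= in_itv/= => X0w.
    apply/eqP/negPn/negP => K0; move: X0w.
    have K0' : 0 < K w [set 0%R] by rewrite lt0e K0 measure_ge0.
    rewrite /X0 /inter_arrival/= last_upto_atom//= subr0.
    by case: next_afterP => //= [_|r r0 _ _]; rewrite ?ltxx// ltNge ltW.
  rewrite Q_X0// => /eqP; rewrite mule_eq0 eqe (gt_eqF lam0)/= => /eqP//.
rewrite -(@setUitv1 _ _ _ _ true)// measureU0//.
exact: (density_law_set1 nuF nuT dF).
Qed.

(** Multiplicity is tested at the numbered points only, which leaves countably many measurable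
    events. *)
Let multiple_back k := [set w | 1 < K w [set back (K w) k]].

Let measurable_multiple_back k : measurable (multiple_back k).
Proof.
pose A := [set p : Omega * R | p.2 = back (K p.1) k].
have mb : measurable_fun setT (fun w => back (K w) k).
  by apply: measurable_back => // B mB; exact: measurable_kernel.
have mA : measurable A.
  have mg : measurable_fun setT (fun p : Omega * R => (p.2 - back (K p.1) k)%R).
    apply: measurable_funB; first exact: measurable_snd.
    exact: (measurableT_comp mb measurable_fst).
  have := mg measurableT _ (measurable_set1 0%R); rewrite setTI.
  congr measurable; apply/seteqP; split => -[w s] /=.
    by move=> /eqP; rewrite subr_eq0 => /eqP.
  by move=> As; rewrite [s](_ : _ = back (K w) k) ?subrr.
have := @measurable_kernel_xsection _ _ _ K Knat _ _ id (@measurable_id _ _ _) A mA.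
move=> /emeasurable_fun_o_infty => /(_ measurableT 1); rewrite setTI.
congr measurable; apply/seteqP; split => w;
  rewrite /multiple_back /= (_ : xsection A w = [set back (K w) k])//;
  by apply/seteqP; split => s; rewrite /xsection /A /= inE.
Qed.

Let Q_multiple_back k : Q (multiple_back k) = 0.
Proof.
rewrite QE; apply: (palm_mass_ae0 flow Kpp).
  exact: measurable_multiple_back.
move: Ksimple; apply: filterS => w simple s; rewrite /multiple_back /=.
rewrite (kernel_flow Kc)// (_ : [set _ | _] =
  [set (back (K (theta s w)) k + s)%R]); first by rewrite ltNge simple.
apply/seteqP; split => x /=; first by move=> <-; rewrite subrK.
by move=> ->; rewrite addrK.
Qed.

(** All past intervals have the law of the first one, which does not charge ]-oo, 0]; a countable
    union of null events thus excludes every degenerate numbering. *)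
Lemma regular_ae : exists B, [/\ measurable B, Q B = 0 &
  forall w, ~ B w -> regular (K w)].
Proof.
have mle0 : measurable (`]-oo, 0%R]%classic : set R) by exact: measurable_itv.
pose Z (b : bool) (n : nat) := if b then [set w | `]-oo, 0%R]%classic (X w n)]
  else multiple_back n.
exists (no_origin `|` [set w | `]-oo, 0%R]%classic (X0 w)] `|`
  ((\bigcup_k Z true k) `|` (\bigcup_k Z false k))).
have mZ b k : measurable (Z b k).
  by case: b; [exact: (mpre (mXk k))|exact: measurable_multiple_back].
have QZ b k : Q (Z b k) = 0.
  case: b; last exact: Q_multiple_back.
  by rewrite /Z Q_past// nu_le0 mule0.
have QUZ b : Q (\bigcup_k Z b k) = 0.
  apply/measure_negligible; first exact: bigcupT_measurable.
  by apply: negligible_bigcup => n; exists (Z b n); split; [exact: mZ|exact: QZ|].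
have mX0' : measurable [set w | `]-oo, 0%R]%classic (X0 w)] by exact: mpre.
have mU1 : measurable (no_origin `|` [set w | `]-oo, 0%R]%classic (X0 w)]).
  exact: measurableU.
have mU2 b : measurable (\bigcup_k Z b k) by exact: bigcupT_measurable.
split.
- by apply: measurableU => //; exact: measurableU.
- apply: measureU_eq0 => //; first exact: measurableU.
    apply: measureU_eq0; [exact: measurable_no_origin|exact: mX0'|
      exact: Q_no_origin|].
    by have := Q_X0 mle0; rewrite nu_le0 mule0.
  by apply: measureU_eq0; [exact: mU2|exact: mU2|exact: QUZ|exact: QUZ].
- move=> w nB; split.
  + rewrite lt0e measure_ge0 andbT; apply/eqP => K0.
    by apply: nB; left; left.
  + rewrite ltNge; apply/negP => h; apply: nB; left; right.
    by rewrite /= in_itv.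
  + move=> k; rewrite ltNge; apply/negP => h; apply: nB; right; left; exists k => //.
  + move=> k; rewrite leNgt; apply/negP => h; apply: nB; right; right.
    by exists k.
Qed.

Lemma palm_eq_regular A1 A2 : measurable A1 -> measurable A2 ->
  (forall w, regular (K w) -> (A1 w <-> A2 w)) -> Q A1 = Q A2.
Proof.
move=> mA1 mA2 A12; have [B [mB QB Breg]] := regular_ae.
rewrite (measure_null_diff (m := Q) mA1 mB QB) (measure_null_diff (m := Q) mA2 mB QB).
congr (Q _); apply/seteqP; split => w [Aw nBw]; split => //.
  by apply/(A12 w) => //; exact: Breg.
by apply/(A12 w) => //; exact: Breg.
Qed.

(** The cut at 0 makes the points at or after t contribute nothing when the hazard at t - s is
    summed over all points s. *)
Definition positive_hazard (u : R) : R :=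
  if (0 < u)%R then hazard_rate F f u else 0%R.

Let c := positive_hazard.

Lemma hazard_rate_ge0 u : (0 <= hazard_rate F f u)%R.
Proof.
rewrite /hazard_rate divr_ge0//; first by case: dF.
by rewrite subr_ge0 (cdf_le1_of_law nuF nuT).
Qed.

Lemma measurable_hazard_rate : measurable_fun setT (hazard_rate F f).
Proof.
apply: measurable_funM; first by case: dF.
apply: (measurableT_comp (@measurable_invr R)); apply: measurable_funB => //.
exact: (measurable_cdf_of_law nuF).
Qed.

Lemma positive_hazard_ge0 u : (0 <= positive_hazard u)%R.
Proof. by rewrite /positive_hazard; case: ifP => // _; exact: hazard_rate_ge0. Qed.

Lemma measurable_positive_hazard : measurable_fun setT positive_hazard.
Proof.
apply: measurable_fun_ifT; last exact: measurable_cst.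
- by apply: measurable_fun_ltr => //; exact: measurable_cst.
- exact: measurable_hazard_rate.
Qed.

(** The identity eta (1 - F) = f. It can fail only at u <= 0, where [c] is cut to 0, and where F =
    1, where the division returns 0; [nu] charges neither set. *)
Let hazard_integral (D : set R) : measurable D ->
  \int[lebesgue_measure]_u ((c u)%:E * ((\1_D u)%:E * (1 - F u)%:E)) = nu D.
Proof.
move=> mD; have [mf f0 _] := dF.
pose U := [set u | F u = 1%R].
have mU : measurable U.
  rewrite (_ : U = F @^-1` [set 1%R])// -[X in measurable X]setTI.
  by apply: (measurable_cdf_of_law nuF) => //; exact: measurable_set1.
pose D' := D `&` `]0%R, +oo[%classic `&` ~` U.
have mD' : measurable D'.
  by apply: measurableI; [exact: measurableI|exact: measurableC].
transitivity (nu D').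
  rewrite (density_law nuF nuT dF)// [in RHS]integral_mkcond.
  apply: eq_integral => u _; rewrite patchE /c /positive_hazard /hazard_rate.
  have [|uD'] := boolP (u \in D').
    rewrite inE => -[[Du]]; rewrite /= in_itv/= andbT => u0 uU.
    rewrite u0 indicE mem_set// mul1e -EFinM divfK// subr_eq0 eq_sym.
    exact/eqP.
  rewrite -!EFinM; congr (_%:E); apply/eqP; rewrite mulf_eq0; apply/orP.
  have [u0|u0] := ltP 0%R u; last by left.
  right; rewrite mulf_eq0 indicE; have [uD|uD] := boolP (u \in D); last by rewrite eqxx.
  apply/orP; right; rewrite subr_eq0 eq_sym; apply/negPn/negP => /eqP uU.
  move/negP : uD'; apply; rewrite inE; split => //; split; first by rewrite -inE.
  by rewrite /= in_itv/= u0.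
have mDp : measurable (D `&` `]0%R, +oo[%classic) by exact: measurableI.
transitivity (nu (D `&` `]0%R, +oo[%classic)).
  rewrite (measure_null_diff (m := nu) mDp mU)//.
  exact: (density_cdf_null nuF nuT dF).
rewrite [RHS](measure_null_diff (m := nu) mD (measurable_itv `]-oo, 0%R]))//.
congr (nu _); apply/seteqP; split => u [Du]; rewrite /= in_itv/= ?andbT.
  by move=> u0; split => //; rewrite /= in_itv/= leNgt u0.
by move=> /negP; rewrite -ltNge => u0; split => //; rewrite /= in_itv/= u0.
Qed.

(** For u > 0 and a regular configuration, the absence of points in ]0, u[ means X_0 >= u. It is
    expressed by masses because Mecke's formula produces it in this form. *)
Let hazard_window (B : set rseq) : set (R * Omega) :=
  [set p | K p.2 `]0%R, p.1[%classic = 0 /\ B (scons p.1 (X p.2))].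

Let measurable_hazard_window B : measurable B -> measurable (hazard_window B).
Proof.
move=> mB; apply: measurableI.
  pose A := [set q : (R * Omega) * R | (0 < q.2)%R && (q.2 < q.1.1)%R].
  have mA : measurable A.
    have m2 : measurable_fun setT (fun q : (R * Omega) * R => q.2).
      exact: measurable_snd.
    have m1 : measurable_fun setT (fun q : (R * Omega) * R => q.1.1).
      exact: (measurableT_comp measurable_fst measurable_fst).
    rewrite (_ : A = [set q | (0 < q.2)%R] `&` [set q | (q.2 < q.1.1)%R]).
      apply: measurableI; last exact: measurable_lt_set.
      by apply: measurable_lt_set => //; exact: measurable_cst.
    by apply/seteqP; split => q; [move=> /andP[? ?]; split|move=> [? ?]; apply/andP; split].
  have := @measurable_kernel_xsection _ _ _ K Knat _ _ snd measurable_snd A mA.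
  move=> /(_ measurableT _ (emeasurable_set1 0)); rewrite setTI.
  congr measurable; apply/seteqP; split => -[u w] /=;
    rewrite (_ : xsection A (u, w) = `]0%R, u[%classic)//;
    by apply/seteqP; split => s; rewrite /xsection /A /= in_itv/= inE.
have mg : measurable_fun setT (fun p : R * Omega => scons p.1 (X p.2) : rseq).
  apply: (@measurable_scons _ _ _ fst (X \o snd)); first exact: measurable_fst.
  exact: measurableT_comp mX measurable_snd.
by rewrite -[X in measurable X]setTI; exact: mg.
Qed.

Let hazard_density (p : measurableTypeR R * Omega) : \bar R :=
  (c p.1)%:E * (\1_(hazard_window setT) p)%:E.

Let hazard_density_ge0 p : 0 <= hazard_density p.
Proof. by rewrite mule_ge0 ?lee_fin// positive_hazard_ge0. Qed.

Let measurable_hazard_density : measurable_fun setT hazard_density.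
Proof.
apply: emeasurable_funM; apply/measurable_EFinP.
  exact: (measurableT_comp measurable_positive_hazard measurable_fst).
by apply: measurable_indic; exact: measurable_hazard_window.
Qed.

Let shift_past (p : measurableTypeR R * Omega) : rseq := scons p.1 (X p.2).

Let measurable_shift_past : measurable_fun setT shift_past.
Proof.
apply: (@measurable_scons _ _ _ fst (X \o snd)); first exact: measurable_fst.
exact: measurableT_comp mX measurable_snd.
Qed.

(** The right-hand side of [past_law] as a measure in B, so that uniqueness of measures applies: the
    law of (u, X_(-1), X_(-2), ...) under c(u) du times Q, restricted to the absence of points in
    ]0, u[. *)
Let shifted_law : {measure set rseq -> \bar R} := image_measure
  (weighted (product_measure1 (@lebesgue_measure R) Q) measurable_hazard_density
    hazard_density_ge0) measurable_shift_past.

Let shifted_lawE (B : set rseq) : measurable B -> shifted_law B =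
  \int[lebesgue_measure]_u ((c u)%:E * Q (xsection (hazard_window B) u)).
Proof.
move=> mB; rewrite /shifted_law /= /image_measure /weighted /=.
have mB' : measurable (shift_past @^-1` B).
  by rewrite -[X in measurable X]setTI; exact: measurable_shift_past.
rewrite integral_mkcond fubini_tonelli1.
- apply: eq_integral => u _; rewrite /fubini_F.
  have mS : measurable (xsection (hazard_window B) u).
    by apply: measurable_xsection; exact: measurable_hazard_window.
  rewrite (eq_integral (fun w => (c u)%:E * (\1_(xsection (hazard_window B) u) w)%:E)).
    rewrite ge0_integralZl ?lee_fin ?positive_hazard_ge0//.
    - by rewrite integral_indic// setIT.
    - by apply/measurable_EFinP; exact: measurable_indic.
  move=> w _; rewrite patchE /hazard_density /= !indicE.
  case: ifPn => [|nB].
    rewrite inE => Bw; congr (_ * (nat_of_bool _)%:R%:E); apply/idP/idP.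
      by rewrite !inE => -[? _]; rewrite /xsection/= inE.
    by rewrite !inE /xsection/= inE => -[].
  rewrite (_ : (w \in _) = false) ?mule0//; apply/negP; rewrite inE /xsection/= inE.
  by move=> -[_ Bw]; move/negP: nB; apply; rewrite inE.
- by apply/(measurable_restrictT _ mB'); exact: measurable_funTS.
- by move=> p; apply: erestrict_ge0 => q _; exact: hazard_density_ge0.
Qed.

Let window_nonempty w u : regular (K w) -> (0 < u)%R ->
  (K w `]0%R, u[%classic = 0 <-> (u <= X0 w)%R).
Proof.
move=> Kreg u0; have [Kn KX0] := regular_next (Knat w) Kreg; split.
  move=> K0; rewrite leNgt; apply/negP => X0u; move: KX0.
  rewrite (@measure_null_le _ _ _ (K w) _ `]0%R, u[%classic) ?ltxx//.
  by move=> _ ->; rewrite /= in_itv/= X0u andbT; case: Kreg.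
move=> uX0; apply: measure_null_le Kn => //.
by apply: subset_itvl; rewrite bnd_simp.
Qed.

(** Cylinders suffice. There the left-hand side is a product of the [nu (D k)]. On the right, the
    constraint [D 0] falls on u, and integrating c(u) nu([u, +oo[) over it gives [nu (D 0)];
    independence supplies the other factors. *)
Lemma past_law (B : set rseq) : measurable B -> Q [set w | B (X w)] =
  \int[lebesgue_measure]_u ((c u)%:E * Q (xsection (hazard_window B) u)).
Proof.
move=> mB; rewrite -shifted_lawE//.
apply: (@measure_unique _ _ rseq (@cylinder R) (fun=> setT) _ _ _ _
  (image_measure Q mX) shifted_law) => //.
- exact: cylinderI.
- move=> _; exists (fun=> setT), 0%N; split => //.
  by apply/esym/seteqP; split.
- by rewrite bigcup_const.
- move=> _ [D [n [mD ->]]].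
  have mC : measurable ([set x | forall k, (k <= n)%N -> D k (x k)] : set rseq).
    by apply: sub_sigma_algebra; exists D, n.
  rewrite shifted_lawE// /image_measure.
  transitivity (lam%:E * (nu setT * \prod_(k < n.+1) nu (D k))).
    rewrite -Q_box//; congr (Q _); apply/seteqP; split => w /=.
      by move=> H; split => // k; rewrite ltnS; exact: H.
    by move=> [_ H] k kn; apply: H; rewrite ltnS.
  rewrite nuT mul1e big_ord_recl/=.
  set p := \prod_(k < n) _.
  transitivity (\int[lebesgue_measure]_u
      ((c u)%:E * ((\1_(D 0%N) u)%:E * (1 - F u)%:E) * (lam%:E * p))).
    rewrite ge0_integralZr//.
    + by rewrite hazard_integral// muleCA.
    + apply: emeasurable_funM.
        by apply/measurable_EFinP; exact: measurable_positive_hazard.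
      apply: emeasurable_funM; apply/measurable_EFinP; first exact: (measurable_indic (mD 0%N)).
      by apply: measurable_funB => //; exact: (measurable_cdf_of_law nuF).
    + move=> u _; rewrite mule_ge0 ?lee_fin ?positive_hazard_ge0//.
      rewrite mulr_ge0// subr_ge0.
      exact: (cdf_le1_of_law nuF nuT).
    + rewrite mule_ge0 ?lee_fin ?(ltW lam0)//; apply: prode_ge0 => k _.
      exact: measure_ge0.
  apply: eq_integral => u _; rewrite -muleA; have [u0|u0] := ltP 0%R u; last first.
    by rewrite /c /positive_hazard ltNge u0/= !mul0e.
  congr (_ * _); have [Du|Du] := boolP (u \in D 0%N); last first.
    rewrite indicE (negbTE Du) !mul0e; apply/esym.
    rewrite (_ : xsection _ _ = set0) ?measure0//; apply/seteqP; split => // w.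
    rewrite /xsection/= inE => -[_ /(_ 0%N (leq0n _))] /= Du'.
    by move/negP: Du; rewrite inE.
  rewrite indicE Du mul1e -(density_ccdf nuF nuT dF) muleCA.
  (* Coordinate k.+1 of the prefixed sequence is the past interval k, hence the shifted index of
     D. *)
  transitivity (Q [set w | `[u, +oo[%classic (X0 w) /\
      forall k, (k < n)%N -> D k.+1 (X w k)]).
    exact/esym/(Q_box n (measurable_itv `[u, +oo[) (fun k => mD k.+1)).
  apply: palm_eq_regular.
  + apply: measurableI; first exact: (mpre mX0 (measurable_itv `[u, +oo[)).
    exact: (@measurable_box (fun k => D k.+1) n (fun k => mD k.+1)).
  + by apply: measurable_xsection; exact: measurable_hazard_window.
  + move=> w Kreg; split.
      move=> [uX0 H]; rewrite /xsection/= inE; split.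
        by apply/(window_nonempty Kreg u0); move: uX0; rewrite /= in_itv/= andbT.
      by move=> [_|k kn] /=; [rewrite -inE|exact: H].
    rewrite /xsection/= inE => -[/(window_nonempty Kreg u0) uX0 H]; split.
      by rewrite /= in_itv/= andbT.
    by move=> k kn; exact: (H k.+1).
- by move=> _; have := ltry lam; rewrite -QT.
Qed.

(** On the left, t is a point; on the right, t comes a time u after the last point.
    [history_representation] reads A through the same B in both cases, which reduces the claim to
    [past_law]. *)
Lemma palm_history (a t : R) (A : set Omega) : (a < t)%R -> measurable A ->
  process_history K a A ->
  palm_mass P theta K [set w | A (theta (- t)%R w)] =
  \int[lebesgue_measure]_u ((positive_hazard u)%:E *
    palm_mass P theta K
      [set w | K w `]0%R, u[%classic = 0 /\ A (theta (u - t)%R w)]).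
Proof.
move=> at_ mA HA; have [B mB HB] := history_representation Kpp Kc at_ HA.
have mAt s : measurable [set w | A (theta s w)].
  have mth := measurable_flow_at flow s.
  by rewrite -[X in measurable X]setTI; exact: mth.
transitivity (Q [set w | B (X w)]).
  apply: palm_eq_regular => //.
    by rewrite -[X in measurable X]setTI; exact: mX.
  by move=> w /HB[].
rewrite past_law; last exact: mB.
apply: eq_integral => u _.
have [u0|u0] := ltP 0%R u; last by rewrite /c /positive_hazard ltNge u0/= !mul0e.
congr (_ * _); apply: palm_eq_regular.
- by apply: measurable_xsection; exact: measurable_hazard_window.
- apply: measurableI; last exact: mAt.
  by have := measurable_kernel K _ (measurable_itv `]0%R, u[) measurableT
    _ (emeasurable_set1 0); rewrite setTI.
- move=> w Kreg; rewrite /xsection/= inE; have [_ Hu] := HB w Kreg.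
  split=> -[K0 h]; split => //; have uX := (window_nonempty Kreg u0).1 K0;
    exact/(Hu u uX).
Qed.

End Renewal.

(** * The intensity of a renewal process *)

Section ReducedIntegral.
Context {d : measure_display} {T : measurableType d} {R : realType}.
Variables (P : probability T R) (G : set (set T)).
Hypothesis G_measurable : forall A, <<s G >> A -> measurable A.

(* A sub-sigma-algebra is a measurable structure on the same carrier, the
   identity being measurable. *)
Lemma integral_indep (A' : set T) (g : T -> \bar R) : measurable A' ->
  (forall B, <<s G >> B -> P (B `&` A') = P B * P A') ->
  (forall w, 0 <= g w) ->
  measurable_fun (setT : set (g_sigma_algebraType G)) g ->
  \int[P]_w ((\1_A' w)%:E * g w) = P A' * \int[P]_w g w.
Proof.
move=> mA' indep g0 mg.
have mid : measurable_fun setT (id : T -> g_sigma_algebraType G).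
  by move=> _ B GB; rewrite setTI; exact: G_measurable.
have mgT : measurable_fun setT g by exact: measurableT_comp mg mid.
transitivity (\int[P]_(w in A') g w).
  rewrite [RHS]integral_mkcond; apply: eq_integral => w _.
  by rewrite patchE indicE; case: ifP => _; rewrite ?mul1e ?mul0e.
have fP : P A' \is a fin_num by exact: fin_num_measure.
have cP : (0 <= fine (P A'))%R by exact: fine_ge0.
pose PA := mrestr P mA'.
transitivity (\int[PA]_(w in A') g w).
  by apply: eq_measure_integral => A mA AA'; rewrite /PA /= /mrestr setIidl.
transitivity (\int[PA]_w g w).
  rewrite (@ge0_negligible_integral _ _ _ PA setT (~` A'))//.
  - by rewrite setTD setCK.
  - exact: measurableC.
  - by rewrite /PA /= /mrestr setICl measure0.
transitivity (\int[image_measure PA mid]_w g w); first by rewrite ge0_integral_image.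
transitivity (\int[mscale (NngNum cP) (image_measure P mid)]_w g w).
  apply: eq_measure_integral => B GB _.
  change (P (B `&` A') = (fine (P A'))%:E * P B).
  by rewrite fineK// muleC indep.
by rewrite ge0_integral_mscale//= fineK// ge0_integral_image.
Qed.

End ReducedIntegral.

Section RenewalIntensity.
Context {d : measure_display} {Omega : measurableType d} {R : realType}.
Variables (P : probability Omega R) (theta : R -> Omega -> Omega).
Hypothesis flow : measurable_flow theta.
Hypothesis invP : flow_preserves P theta.
Variable K : R.-ker Omega ~> R.
Hypothesis Kpp : point_process K.
Hypothesis Kc : flow_compatible theta K.
Hypothesis Ksimple : simple_process P K.
Hypothesis Kiid : iid_inter_arrivals P theta K.
Hypothesis Kint : 0 < intensity P K < +oo.
Variable f : R -> R.
Let F := inter_arrival_cdf P theta K.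
Hypothesis dF : is_density F f.
Let Knat w : nat_valued (K w). Proof. exact: point_process_nat. Qed.
Let Klty : intensity P K < +oo. Proof. by case/andP: Kint. Qed.
Let Q : {finite_measure set Omega -> \bar R} := palm_measure flow Kpp Klty.

Let H := current_hazard P theta K f.
Let hz := hazard_rate F f.
Let pz := positive_hazard P theta K f.

Lemma current_hazard_ge0 t w : (0 <= H t w)%R.
Proof.
rewrite /H /current_hazard; case: last_before => // r.
exact: (hazard_rate_ge0 flow Kpp Kint dF).
Qed.

(** The space X is arbitrary because the hazard is needed under several sigma-algebras: the product
    one, the one generated by a single process, and the predictable one. *)
Lemma measurable_current_hazard_comp d' (X : measurableType d') (tau : X -> R)
    (g : X -> Omega) : measurable_fun setT tau ->
  measurable_fun setT (fun x => last_before (K (g x)) (tau x)) ->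
  measurable_fun setT (fun x => H (tau x) (g x)).
Proof.
move=> mtau mlb; pose lb x := last_before (K (g x)) (tau x).
pose D := [set x | -oo < lb x] `&` [set x | lb x < +oo].
have mD : measurable D.
  apply: measurableI; rewrite -[X in measurable X]setTI.
    exact: emeasurable_fun_o_infty.
  exact: emeasurable_fun_infty_o.
rewrite (_ : (fun x => _) = (fun x => \1_D x * hz (tau x - fine (lb x)))%R).
  apply: measurable_funM; first exact: measurable_indic.
  apply: (measurableT_comp (measurable_hazard_rate flow Kpp Kint dF)).
  apply: measurable_funB => //.
  exact: (measurableT_comp (fine_measurable measurableT) mlb).
apply/funext => x; rewrite /H /current_hazard indicE /D /lb.
case E : (last_before _ _) => [r||] /=.
- by rewrite mem_set ?mul1r//=; split => /=; rewrite E ?ltNyr ?ltry.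
- by rewrite memNset ?mul0r// => -[_ /=]; rewrite E ltxx.
- by rewrite memNset ?mul0r// => -[/=]; rewrite E ltxx.
Qed.

Lemma measurable_current_hazard :
  measurable_fun setT (fun p : R * Omega => H p.1 p.2).
Proof.
apply: measurable_current_hazard_comp; first exact: measurable_fst.
apply: (@measurable_last_before_comp _ _ _ (fun p : R * Omega => K p.2)) => //.
  by move=> B mB; exact: (measurableT_comp (measurable_kernel K _ mB) measurable_snd).
Qed.

Lemma measurable_current_hazard_at t : measurable_fun setT (H t).
Proof.
apply: (@measurable_current_hazard_comp _ _ (cst t) id) => //.
apply: (measurable_last_before_comp (mu := K)) => // B mB.
exact: measurable_kernel.
Qed.

(** The second component is a configuration seen from s: at (s, theta_s w) the condition says that
    [K w] has no point in ]s, t[. *)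
Let gap (t : R) : set (R * Omega) := [set p | K p.2 `]0%R, (t - p.1)%R[%classic = 0].

Let measurable_gap t : measurable (gap t).
Proof.
pose A := [set q : (R * Omega) * R | (0 < q.2)%R /\ (q.2 < t - q.1.1)%R].
have mA : measurable A.
  have m2 : measurable_fun setT (fun q : (R * Omega) * R => q.2).
    exact: measurable_snd.
  have m1 : measurable_fun setT (fun q : (R * Omega) * R => q.1.1).
    exact: (measurableT_comp measurable_fst measurable_fst).
  apply: measurableI.
    by apply: measurable_lt_set => //; exact: measurable_cst.
  apply: measurable_lt_set => //.
  by apply: measurable_funB => //; exact: measurable_cst.
have := @measurable_kernel_xsection _ _ _ K Knat _ _ snd measurable_snd A mA.
move=> /(_ measurableT _ (emeasurable_set1 0)); rewrite setTI.
congr measurable; apply/seteqP; split => -[u w] /=;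
  rewrite (_ : xsection A (u, w) = `]0%R, (t - u)%R[%classic)//;
  by apply/seteqP; split => s; rewrite /xsection /A /= in_itv/= inE => /andP//.
Qed.

(** In this sum over all points s only the last one before t survives, and it has mass 1. The hazard
    thereby takes the form to which Mecke's formula applies. *)
Lemma current_hazard_kernel w : (forall s, K w [set s] <= 1) -> forall t,
  (H t w)%:E =
  \int[K w]_s ((pz (t - s)%R)%:E * (\1_(gap t) (s, theta s w))%:E).
Proof.
move=> simple t.
have gapE s : gap t (s, theta s w) <-> K w `]s, t[%classic = 0.
  rewrite /gap /= (kernel_flow Kc)// (_ : [set _ | _] = `]s, t[%classic)//.
  by apply/seteqP; split => x; rewrite /= !in_itv/= subr_gt0 ltrD2r.
pose g s := (pz (t - s)%R)%:E * (\1_(gap t) (s, theta s w))%:E.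
have g0 s : 0 <= g s.
  by rewrite mule_ge0 ?lee_fin// (positive_hazard_ge0 flow Kpp Kint dF).
have mg : measurable_fun setT g.
  apply: emeasurable_funM; apply/measurable_EFinP.
    apply: (measurableT_comp (measurable_positive_hazard flow Kpp Kint dF)).
    by apply: measurable_funB => //; exact: measurable_cst.
  apply: (measurableT_comp (measurable_indic (measurable_gap t))).
  apply: measurable_fun_pair; first exact: measurable_id.
  by apply: (measurable_flow_comp flow); [exact: measurable_id|exact: measurable_cst].
have gout s : (t <= s)%R -> g s = 0.
  by move=> ts; rewrite /g /pz /positive_hazard subr_gt0 ltNge ts/= mul0e.
rewrite -/g /H /current_hazard; case: (last_beforeP t (Knat w)) => [K0|r rt Kr K0].
  rewrite (_ : 0%:E = \int[K w]_(x in setT) 0); last by rewrite integral0.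
  apply/esym.
  apply: ge0_ae_eq_integral => //; first by move=> s _; exact: g0.
  exists `]-oo, t[%classic; split => //.
  move=> s /= /not_implyP[_ /eqP gs]; rewrite in_itv/= ltNge; apply/negP => ts.
  by move/eqP: gs; apply; exact: gout ts.
have Kr1 : K w [set r] = 1.
  apply/eqP; rewrite eq_le simple leNgt; apply/negP => /(nat_valued_lt1 (Knat w)).
  move=> /(_ r r (measurable_set1 r)) h.
  by move: Kr; rewrite h ?ltxx// set_itv1.
transitivity (\int[K w]_s ((hz (t - r)%R)%:E * (\1_[set r] s)%:E)).
  rewrite ge0_integralZl//.
  - by rewrite integral_indic// setIT Kr1 mule1.
  - by apply/measurable_EFinP; exact: measurable_indic.
  - by rewrite lee_fin (hazard_rate_ge0 flow Kpp Kint dF).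
apply: ge0_ae_eq_integral => //.
- by apply: emeasurable_funM => //; apply/measurable_EFinP; exact: measurable_indic.
- by move=> s _; rewrite mule_ge0 ?lee_fin// (hazard_rate_ge0 flow Kpp Kint dF).
- by move=> s _; exact: g0.
(* The integrands differ at most on ]r, t[, which is null: before r the gap condition fails because
   of the point r, and from t on the hazard is cut off. *)
exists `]r, t[%classic; split => // s /= /not_implyP[_]; rewrite in_itv/=.
rewrite -/(g s); apply: contra_notT; rewrite negb_and -!leNgt => /orP[sr|ts]; last first.
  rewrite gout// indicE memNset ?mule0// => /= sr.
  by move: ts; rewrite sr leNgt rt.
move: sr; rewrite le_eqVlt => /orP[/eqP ->|sr].
  rewrite /g /pz /positive_hazard subr_gt0 rt !indicE !mem_set//.
  exact/gapE.
rewrite /g !indicE !memNset ?mule0//.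
  move=> /gapE Ks; move: Kr; rewrite (measure_null_le _ _ _ Ks) ?ltxx//.
  by move=> _ ->; rewrite /= in_itv/= sr.
by move=> /= sr'; rewrite sr' ltxx in sr.
Qed.

Let mpre (A : set Omega) s : measurable A -> measurable [set w | A (theta s w)].
Proof.
move=> mA; have mth := measurable_flow_at flow s.
by rewrite -[X in measurable X]setTI; exact: mth.
Qed.

Let mback (A : set Omega) : measurable A ->
  measurable [set p : R * Omega | A (theta (- p.1)%R p.2)].
Proof.
move=> mA; have mth : measurable_fun setT (fun p : R * Omega => theta (- p.1)%R p.2).
  apply: (measurable_flow_comp flow); last exact: measurable_snd.
  by apply: measurable_funN; exact: measurable_fst.
by rewrite -[X in measurable X]setTI; exact: mth.
Qed.

Let mpz : measurable_fun setT pz.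
Proof. exact: (measurable_positive_hazard flow Kpp Kint dF). Qed.

Let mpzt t : measurable_fun setT (fun s : R => pz (t - s)%R).
Proof.
apply: (measurableT_comp mpz).
by apply: measurable_funB => //; exact: measurable_cst.
Qed.

Let pz0 u : (0 <= pz u)%R.
Proof. exact: (positive_hazard_ge0 flow Kpp Kint dF). Qed.

(** Mecke's formula wants a function of (s, theta_s w), so A is read back through theta_(-s). *)
Let expectation_hazard_kernel t (A : set Omega) : measurable A ->
  \int[P]_w ((\1_A w)%:E * (H t w)%:E) =
  \int[P]_w \int[K w]_s ((pz (t - s)%R)%:E *
    (\1_(gap t `&` [set p | A (theta (- p.1)%R p.2)]) (s, theta s w))%:E).
Proof.
move=> mA; set D := gap t `&` _.
have mD : measurable D by apply: measurableI; [exact: measurable_gap|exact: mback].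
have msec w : measurable_fun setT (fun s => (s, theta s w)).
  apply: measurable_fun_pair; first exact: measurable_id.
  by apply: (measurable_flow_comp flow); [exact: measurable_id|exact: measurable_cst].
apply: ge0_ae_eq_integral.
- by [].
- apply: emeasurable_funM; apply/measurable_EFinP; first exact: measurable_indic.
  exact: measurable_current_hazard_at.
- apply: (@measurable_kernel_integral _ _ _ K Knat _ _ id (@measurable_id _ _ _)
    (fun p => (pz (t - p.2)%R)%:E * (\1_D (p.2, theta p.2 p.1))%:E)).
    by move=> p; rewrite mule_ge0 ?lee_fin.
  apply: emeasurable_funM; apply/measurable_EFinP.
    exact: (measurableT_comp (mpzt t) measurable_snd).
  apply: (measurableT_comp (measurable_indic mD)).
  apply: measurable_fun_pair; first exact: measurable_snd.
  by apply: (measurable_flow_comp flow); [exact: measurable_snd|exact: measurable_fst].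
- by move=> w _; rewrite mule_ge0 ?lee_fin// current_hazard_ge0.
- by move=> w _; apply: integral_ge0 => s _; rewrite mule_ge0 ?lee_fin.
move: Ksimple; apply: filterS => w simple _.
rewrite current_hazard_kernel// -ge0_integralZl//.
- apply: eq_integral => s _; rewrite muleCA; congr (_ * _).
  rewrite /D indicI /= EFinM muleC; congr (_ * _%:E).
  by apply: indic_iff; rewrite /= flowNK.
- apply: emeasurable_funM; apply/measurable_EFinP; first exact: mpzt.
  exact: (measurableT_comp (measurable_indic (measurable_gap t)) (msec w)).
- by move=> s _; rewrite mule_ge0 ?lee_fin.
Qed.

Let measurable_palm_hazard (A : set Omega) t : measurable A ->
  measurable_fun setT (fun u : R => palm_mass P theta K
    [set w | K w `]0%R, u[%classic = 0 /\ A (theta (u - t)%R w)]).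
Proof.
move=> mA; pose E : set (R * Omega) :=
  [set p | K p.2 `]0%R, p.1[%classic = 0 /\ A (theta (p.1 - t)%R p.2)].
have mE : measurable E.
  have mref : measurable_fun setT (fun p : R * Omega => ((t - p.1)%R, p.2)).
    apply: measurable_fun_pair; last exact: measurable_snd.
    by apply: measurable_funB; [exact: measurable_cst|exact: measurable_fst].
  have := mref measurableT _ (measurableI _ _ (measurable_gap t) (mback mA)).
  rewrite setTI; congr measurable; apply/seteqP.
  by split => p; rewrite /gap /E /= opprB addrCA subrr addr0.
have := @measurable_fun_xsection _ _ R Omega R Q E mE.
congr (measurable_fun _ _); apply/funext => u; congr (palm_mass _ _ _ _).
by apply/seteqP; split => w; rewrite /xsection /E/= inE.
Qed.

Lemma expectation_hazard (a t : R) (A : set Omega) : (a < t)%R ->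
  measurable A -> process_history K a A ->
  \int[P]_w ((\1_A w)%:E * (H t w)%:E) =
  palm_mass P theta K [set w | A (theta (- t)%R w)].
Proof.
move=> at_ mA HA.
rewrite expectation_hazard_kernel// (mecke_indic flow invP Kpp Kc); first last.
- by apply: measurableI; [exact: measurable_gap|exact: mback].
- exact: mpzt.
- by move=> s; exact: pz0.
rewrite (palm_history flow Kpp Kc Ksimple Kiid Kint dF at_ mA HA).
pose E u := [set w | K w `]0%R, u[%classic = 0 /\ A (theta (u - t)%R w)].
pose h u := (pz u)%:E * palm_mass P theta K (E u).
transitivity (\int[lebesgue_measure]_s h (t - s)%R).
  apply: eq_integral => s _; rewrite /h.
  rewrite (_ : xsection _ _ = E (t - s)%R)//.
  rewrite /E addrAC subrr add0r; apply/seteqP; split => w; rewrite /xsection/= inE;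
    exact.
apply: ge0_integral_reflect.
- apply: emeasurable_funM; first exact/measurable_EFinP.
  exact: measurable_palm_hazard.
- by move=> u; rewrite mule_ge0 ?lee_fin ?pz0//; exact: integral_ge0.
Qed.

(** For t > a and A a past event at time a, the Palm mass on the right is the value of E[1_A eta(t)]
    given by [expectation_hazard]; the two lemmas meet there. *)
Lemma expectation_count (a b : R) (A : set Omega) : measurable A ->
  \int[P]_w ((\1_A w)%:E * K w `]a, b]%classic) =
  \int[lebesgue_measure]_t ((\1_(`]a, b]%classic) t)%:E *
    palm_mass P theta K [set w | A (theta (- t)%R w)]).
Proof.
move=> mA.
pose D := [set p : R * Omega | A (theta (- p.1)%R p.2)].
have mD : measurable D.
  have mth : measurable_fun setT (fun p : R * Omega => theta (- p.1)%R p.2).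
    apply: (measurable_flow_comp flow); last exact: measurable_snd.
    by apply: measurable_funN; exact: measurable_fst.
  by rewrite -[X in measurable X]setTI; exact: mth.
transitivity (\int[P]_w \int[K w]_s
    ((\1_(`]a, b]%classic) s)%:E * (\1_D (s, theta s w))%:E)).
  apply: eq_integral => w _.
  transitivity (\int[K w]_s ((\1_A w)%:E * (\1_(`]a, b]%classic) s)%:E)).
    rewrite ge0_integralZl ?lee_fin//.
      by rewrite integral_indic// setIT.
    by apply/measurable_EFinP; exact: measurable_indic.
  apply: eq_integral => s _; rewrite muleC; congr (_ * _).
  by congr (_%:E); apply: indic_iff; rewrite /D /= flowNK.
rewrite (mecke_indic flow invP Kpp Kc); first last.
- exact: mD.
- exact: measurable_indic.
- by [].
apply: eq_integral => s _; congr (_ * palm_mass _ _ _ _).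
by apply/seteqP; split => w; rewrite /xsection/= inE.
Qed.

End RenewalIntensity.

(** * Intensity with respect to the joint history *)

Section ProcessSigma.
Context {d : measure_display} {Omega : measurableType d} {R : realType}.
Variable K : R.-ker Omega ~> R.

Definition process_events : set (set Omega) :=
  \bigcup_(B in [set B : set R | measurable B])
    preimage_set_system setT (fun w => K w B) measurable.

Lemma process_sigma_measurable A : process_sigma K A -> measurable A.
Proof.
apply: (@smallest_sub _ _ _ measurable).
  split; [exact: measurable0|by move=> ? ?; rewrite setTD; exact: measurableC|].
  by move=> ? ?; exact: bigcupT_measurable.
by move=> _ [B /= mB [V mV <-]]; exact: measurable_kernel.
Qed.

Lemma process_history_sigma a A : process_history K a A -> process_sigma K A.
Proof.
apply: smallest_sub; first exact: smallest_sigma_algebra.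
move=> _ [I _ [V mV <-]]; apply: sub_sigma_algebra.
by exists `]I.1, I.2]%classic; [exact: measurable_itv|exists V].
Qed.

Lemma process_history_mono a b A : (a <= b)%R ->
  process_history K a A -> process_history K b A.
Proof.
move=> ab; apply: sub_smallest2r; first exact: smallest_sigma_algebra.
move=> E [I [I12 Ia] HI]; exists I => //; split => //.
exact: le_trans ab.
Qed.

Lemma process_historyT a : process_history K a setT.
Proof.
rewrite -(setD0 setT); apply: sigma_algebraCD; exact: sigma_algebra0.
Qed.

Lemma process_historyI a A B : process_history K a A ->
  process_history K a B -> process_history K a (A `&` B).
Proof.
move=> HA HB.
by have := @measurableI _ (g_sigma_algebraType (\bigcup_(I in
  [set I : R * R | (I.1 < I.2)%R /\ (I.2 <= a)%R])
        preimage_set_system setT (fun w => K w `]I.1, I.2]%classic)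
          measurable)) A B HA HB.
Qed.

Lemma process_history_measurable a A : process_history K a A -> measurable A.
Proof. by move=> /process_history_sigma/process_sigma_measurable. Qed.

End ProcessSigma.

Section PredictableIntensity.
Context {d : measure_display} {Omega : measurableType d} {R : realType}
  {N : nat}.
Variables (P : probability Omega R) (theta : R -> Omega -> Omega).
Variables (Phi : 'I_N -> R.-ker Omega ~> R) (f : 'I_N -> R -> R).
Hypothesis flow : measurable_flow theta.
Hypothesis invP : flow_preserves P theta.
Hypothesis renewalPhi : forall i, stationary_renewal P theta (Phi i).
Hypothesis indepPhi : independent_processes P Phi.
Hypothesis intensityPhi : forall i, 0 < intensity P (Phi i) < +oo.
Hypothesis densityPhi :
  forall i, is_density (inter_arrival_cdf P theta (Phi i)) (f i).

Let pp i : point_process (Phi i). Proof. by case: (renewalPhi i) => -[]. Qed.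
Let fc i : flow_compatible theta (Phi i).
Proof. by case: (renewalPhi i) => -[]. Qed.
Let simple i : simple_process P (Phi i). Proof. by case: (renewalPhi i). Qed.
Let iid i : iid_inter_arrivals P theta (Phi i).
Proof. by case: (renewalPhi i). Qed.
Let Knat i w : nat_valued (Phi i w). Proof. exact: point_process_nat. Qed.

Definition box (A : 'I_N -> set Omega) : set Omega := [set w | forall j, A j w].

(** The interval may be empty, so that the family is closed under intersection: the meet has the
    larger left end, to which both histories extend. *)
Definition history_boxes : set (set (R * Omega)) := [set E | exists a b A,
  (forall j, process_history (Phi j) a (A j)) /\ E = `]a, b]%classic `*` box A].

Lemma measurable_box_events (A : 'I_N -> set Omega) :
  (forall j, measurable (A j)) -> measurable (box A).
Proof.
move=> mA; rewrite (_ : box A = \big[setI/setT]_(j < N) A j).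
  by apply: bigsetI_measurable => j _; exact: mA.
apply/seteqP; split => w.
  by move=> Aw; apply: (big_ind (fun B : set Omega => B w)) => // B B' ? ?; split.
by move=> + j; rewrite (bigD1 j)//= => -[].
Qed.

Lemma history_boxes_measurable : history_boxes `<=` measurable.
Proof.
move=> _ [a [b [A [HA ->]]]]; apply: measurableX; first exact: measurable_itv.
by apply: measurable_box_events => j; exact: process_history_measurable (HA j).
Qed.

Lemma history_boxesI : setI_closed history_boxes.
Proof.
move=> _ _ [a [b [A [HA ->]]]] [a' [b' [A' [HA' ->]]]].
exists (Num.max a a'), (Num.min b b'), (fun j => A j `&` A' j); split.
  move=> j; apply: process_historyI.
    by apply: process_history_mono (HA j); rewrite le_max lexx.
  by apply: process_history_mono (HA' j); rewrite le_max lexx orbT.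
apply/seteqP; split => -[t w] /=; rewrite !in_itv/= gt_max le_min.
  by move=> [[/andP[-> ->] Aw] [/andP[-> ->] Aw']]; split => // j; split.
move=> [/andP[/andP[-> ->] /andP[-> ->]] Aw].
by split; split => // j; case: (Aw j).
Qed.

(** For fixed ]a, b], the sets A whose product with it is generated form a sigma-algebra containing
    each single history. Complements are taken inside the strip ]a, b] x Omega, which is itself a
    box. *)
Lemma predictable_sub : predictable Phi `<=` <<s history_boxes >>.
Proof.
apply: smallest_sub; first exact: smallest_sigma_algebra.
move=> _ [a [b [A [ab + ->]]]].
have boxT : <<s history_boxes >> (`]a, b]%classic `*` setT).
  apply: sub_sigma_algebra; exists a, b, (fun=> setT); split.
    by move=> j; exact: process_historyT.
  by congr (_ `*` _); apply/esym/seteqP; split.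
apply: (@smallest_sub _ _ _ [set A | <<s history_boxes >> (`]a, b]%classic `*` A)]).
  pose G := g_sigma_algebraType history_boxes.
  split => /=.
  - by rewrite setX0; exact: sigma_algebra0.
  - move=> B HB; have := @measurableD _ G _ _ boxT HB.
    congr (<<s history_boxes >> _); apply/seteqP; split => -[t w] /=.
      by move=> [[tI _] nB]; split => //; split => // Bw; apply: nB.
    by move=> [tI [_ nB]]; split => // -[_].
  - move=> B HB; have := @bigcupT_measurable _ G _ HB.
    by rewrite setX_bigcupr.
move=> B [j _ HB]; apply: sub_sigma_algebra.
exists a, b, (fun k => if k == j then B else setT); split.
  by move=> k; case: eqP => [->//|_]; exact: process_historyT.
congr (_ `*` _); apply/seteqP; split => w.
  by move=> Bw k; case: eqP.
by move=> /(_ j); rewrite eqxx.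
Qed.

Variable i : 'I_N.
Let K := Phi i.
Let H := current_hazard P theta K (f i).

Let others (A : 'I_N -> set Omega) : set Omega :=
  box (fun j => if j == i then setT else A j).

Let box_others A : box A = others A `&` A i.
Proof.
apply/seteqP; split => [w Aw|w [Aw Ai] j].
  by split => // j; case: eqP.
by have := Aw j; case: eqP => [->|].
Qed.

Let indic_box A w : \1_(box A) w = (\1_(others A) w * \1_(A i) w)%R :> R.
Proof. by rewrite box_others indicI. Qed.

Let others_indep A B : (forall j, process_sigma (Phi j) (A j)) ->
  process_sigma K B -> P (B `&` others A) = P B * P (others A).
Proof.
move=> HA HB.
have sT (j : 'I_N) : process_sigma (Phi j) setT.
  by rewrite -(setD0 setT); apply: sigma_algebraCD; exact: sigma_algebra0.
pose Ai B' := (fun j => if j == i then B' else A j).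
have HAi B' : process_sigma K B' -> forall j, process_sigma (Phi j) (Ai B' j).
  by move=> HB' j; rewrite /Ai; case: eqP => [->|].
have -> : B `&` others A = [set w | forall j, Ai B j w].
  apply/seteqP; split => [w [Bw Aw] j|w Aw].
    by have := Aw j; rewrite /Ai; case: eqP.
  split; first by have := Aw i; rewrite /Ai eqxx.
  by move=> j; have := Aw j; rewrite /Ai; case: eqP.
have -> : others A = [set w | forall j, Ai setT j w] by [].
rewrite (indepPhi (HAi B HB)) (indepPhi (HAi setT (sT i))).
rewrite (bigD1 i)//= [in RHS](bigD1 i)//= /Ai eqxx probability_setT mul1e.
by congr (_ * _); apply: eq_bigr => j /negbTE ->.
Qed.

Let measurable_others (a : R) A : (forall j, process_history (Phi j) a (A j)) ->
  measurable (others A).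
Proof.
move=> HA; apply: measurable_box_events => j.
by case: eqP => // _; exact: process_history_measurable (HA j).
Qed.

Let process_fun B (V : set (\bar R)) : measurable B -> measurable V ->
  process_sigma K [set w | V (K w B)].
Proof.
by move=> mB mV; apply: sub_sigma_algebra; exists B => //; exists V => //; rewrite setTI.
Qed.

Let process_kernel B : measurable B -> measurable_fun
  (setT : set (g_sigma_algebraType (process_events K))) (fun w => K w B).
Proof. by move=> mB _ V mV; rewrite setTI; exact: process_fun. Qed.

Let process_indic A : process_sigma K A -> measurable_fun
  (setT : set (g_sigma_algebraType (process_events K)))
  (fun w => (\1_A w)%:E : \bar R).
Proof.
move=> HA; apply/measurable_EFinP.
exact: (@measurable_indic _ (g_sigma_algebraType (process_events K)) R setT A HA).
Qed.

Let process_hazard t : measurable_fun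
  (setT : set (g_sigma_algebraType (process_events K))) (fun w => (H t w)%:E).
Proof.
apply/measurable_EFinP.
apply: (measurable_current_hazard_comp flow (@pp i) (intensityPhi i) (densityPhi i)
  (X := g_sigma_algebraType (process_events K)) (tau := cst t) (g := id)).
  exact: measurable_cst.
apply: (@measurable_last_before R _ (g_sigma_algebraType (process_events K))
  (fun w => K w) _ (cst t)).
  exact: Knat.
move=> a b; case: (ltP b t) => bt.
  rewrite (_ : [set x | _] = [set w : Omega | 0 < K w `]a, b]%classic]).
    apply: (@process_fun _ [set x : \bar R | 0 < x]); first exact: measurable_itv.
    by rewrite -set_itv_o_infty; exact: emeasurable_itv.
  by apply/seteqP; split => w /=; [case|].
rewrite (_ : [set x | _] = set0); first exact: sigma_algebra0.
by apply/seteqP; split => w //= -[].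
Qed.

(** Independence pulls out the events of the other processes. The same factor appears for the count
    and for the hazard, which reduces their comparison to one process. *)
Let integral_box (a : R) (A : 'I_N -> set Omega) (g : Omega -> \bar R) :
  (forall j, process_history (Phi j) a (A j)) -> (forall w, 0 <= g w) ->
  measurable_fun (setT : set (g_sigma_algebraType (process_events K))) g ->
  \int[P]_w ((\1_(box A) w)%:E * g w) =
  P (others A) * \int[P]_w ((\1_(A i) w)%:E * g w).
Proof.
move=> HA g0 mg; rewrite -(@integral_indep _ _ _ P (process_events K)).
- by apply: eq_integral => w _; rewrite indic_box EFinM muleA.
- exact: process_sigma_measurable.
- exact: measurable_others HA.
- move=> B HB; apply: others_indep => // j; exact: process_history_sigma (HA j).
- by move=> w; rewrite mule_ge0 ?lee_fin.
- by apply: emeasurable_funM => //; apply: process_indic; exact: process_history_sigma (HA i).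
Qed.

Let lambda := fine (intensity P K).

Lemma expectation_interval (a b : R) : (a <= b)%R ->
  \int[P]_w K w `]a, b]%classic = (lambda * (b - a))%:E.
Proof.
move=> ab.
transitivity (\int[P]_w ((\1_setT w)%:E * K w `]a, b]%classic)).
  by apply: eq_integral => w _; rewrite indicT mul1e.
rewrite (expectation_count flow invP (@pp i) (@fc i))//.
transitivity (\int[lebesgue_measure]_t ((\1_(`]a, b]%classic) t)%:E * intensity P K)).
  by apply: eq_integral => t _; rewrite -(palm_massT P theta K).
rewrite ge0_integralZr//.
- rewrite integral_indic// setIT.
  change (lebesgue_measure (`]a, b]%classic : set R) * intensity P K =
    (lambda * (b - a))%:E).
  rewrite lebesgue_measure_itv/= lte_fin.
  rewrite -[intensity P K]fineK; last first.
    by case/andP: (intensityPhi i) => l0 l1; rewrite fin_numElt l1 (lt_trans _ l0).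
  case: ltP ab => [_ _|ba ab]; first by rewrite -EFinD -EFinM mulrC.
  by rewrite (le_anti (introT andP (conj ab ba))) subrr mulr0 mul0e.
- by apply/measurable_EFinP; exact: measurable_indic.
- by case/andP: (intensityPhi i) => /ltW.
Qed.

Let hazard_density (p : measurableTypeR R * Omega) : \bar R := (H p.1 p.2)%:E.

Let H_ge0 t w : (0 <= H t w)%R.
Proof. exact: (current_hazard_ge0 flow (@pp i) (intensityPhi i) (densityPhi i)). Qed.

Let hazard_density_ge0 p : 0 <= hazard_density p.
Proof. by rewrite lee_fin. Qed.

Let measurable_retype : measurable_fun setT (fun p : measurableTypeR R * Omega => p : R * Omega).
Proof.
have h := measurable_fun_pair (f := fun p : measurableTypeR R * Omega => p.1 : R)
  (g := snd) measurable_fst measurable_snd.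
rewrite (_ : (fun p => _) = (fun p => (p.1 : R, p.2))) //.
by apply/funext => -[].
Qed.

Let mH : measurable_fun setT (fun p : R * Omega => (H p.1 p.2)%:E).
Proof.
apply/measurable_EFinP.
exact: (measurable_current_hazard flow (@pp i) (intensityPhi i) (densityPhi i)).
Qed.

Let measurable_hazard_density : measurable_fun setT hazard_density.
Proof. exact: (measurableT_comp mH measurable_retype). Qed.

(** The image under the identity moves the measure from [measurableTypeR R] to the time axis R of
    the predictable sets. *)
Let hazard_measure : {measure set (R * Omega) -> \bar R} :=
  image_measure (weighted (product_measure1 (@lebesgue_measure R) P)
    measurable_hazard_density hazard_density_ge0) measurable_retype.

Let hazard_measureE E : measurable E -> hazard_measure E =
  \int[lebesgue_measure]_t \int[P]_w ((\1_E (t, w))%:E * (H t w)%:E).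
Proof.
move=> mE; rewrite /hazard_measure/= /image_measure/= /weighted/=.
rewrite integral_mkcond.
transitivity (\int[product_measure1 (@lebesgue_measure R) P]_p
    ((\1_E p)%:E * hazard_density p)).
  apply: eq_integral => p _; rewrite patchE indicE /preimage/=.
  by rewrite (_ : (p \in [set t | E t]) = (p \in E))//; case: ifP => _;
    rewrite ?mul1e ?mul0e.
rewrite fubini_tonelli1//.
- apply: emeasurable_funM => //; apply/measurable_EFinP.
  exact: (measurableT_comp (measurable_indic mE) measurable_retype).
- by move=> p; rewrite mule_ge0 ?lee_fin.
Qed.

Let measurable_palm_back A : measurable A ->
  measurable_fun setT (fun t : R => palm_mass P theta K [set w | A (theta (- t)%R w)]).
Proof.
move=> mA; pose D := [set p : R * Omega | A (theta (- p.1)%R p.2)].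
have mD : measurable D.
  have mth : measurable_fun setT (fun p : R * Omega => theta (- p.1)%R p.2).
    apply: (measurable_flow_comp flow); last exact: measurable_snd.
    by apply: measurable_funN; exact: measurable_fst.
  by rewrite -[X in measurable X]setTI; exact: mth.
have Kfin : intensity P K < +oo by case/andP: (intensityPhi i).
have := @measurable_fun_xsection _ _ R Omega R
  (palm_measure flow (@pp i) Kfin : {finite_measure set Omega -> \bar R}) D mD.
congr (measurable_fun _ _); apply/funext => t; congr (palm_mass _ _ _ _).
by apply/seteqP; split => w; rewrite /xsection/= inE.
Qed.

Let hazard_measure_box a b A : (forall j, process_history (Phi j) a (A j)) ->
  campbell P K (`]a, b]%classic `*` box A) =
  hazard_measure (`]a, b]%classic `*` box A).
Proof.
move=> HA.
have mbox : measurable (box A).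
  by apply: measurable_box_events => j; exact: process_history_measurable (HA j).
have mAi := process_history_measurable (HA i).
rewrite hazard_measureE; last by apply: measurableX => //; exact: measurable_itv.
transitivity (\int[P]_w ((\1_(box A) w)%:E * K w `]a, b]%classic)).
  apply: eq_integral => w _; rewrite indicE.
  case: (boolP (w \in box A)); rewrite ?inE ?notin_setE => Aw.
    rewrite mul1e; congr (K w _).
    by apply/seteqP; split => t; rewrite /ysection/= inE/= => // -[].
  rewrite mul0e (_ : ysection _ _ = set0) ?measure0//.
  by apply/seteqP; split => t; rewrite /ysection/= ?inE//= => -[].
rewrite (integral_box HA)//; last by apply: process_kernel; exact: measurable_itv.
rewrite (expectation_count flow invP (@pp i) (@fc i))//.
rewrite -ge0_integralZl//; last first.
- by move=> t _; rewrite mule_ge0 ?lee_fin//; exact: integral_ge0.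
- apply: emeasurable_funM; first by apply/measurable_EFinP; exact: measurable_indic.
  exact: measurable_palm_back.
apply: eq_integral => t _; rewrite muleCA indicE.
case: (boolP (t \in _)); rewrite ?inE ?notin_setE/= => tI; last first.
  rewrite mul0e integral0_eq// => w _; rewrite indicE memNset ?mul0e//.
  by move=> [].
have at_ : (a < t)%R by move: tI; rewrite in_itv/= => /andP[].
rewrite mul1e -(expectation_hazard flow invP (@pp i) (@fc i) (@simple i) (@iid i)
  (intensityPhi i) (densityPhi i) at_ mAi (HA i)).
rewrite -(integral_box (g := fun w => (H t w)%:E) HA); [|by move=> w; rewrite lee_fin|exact: process_hazard].
apply: eq_integral => w _; congr ((_%:E) * _); apply: indic_iff => /=.
by split => [|[]].
Qed.

(** Two measures that agree on the boxes; the strips ]-k, k] x Omega exhaust the space, with finite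
    Campbell mass 2 k lambda. *)
Lemma campbell_predictable E : predictable Phi E -> campbell P K E =
  \int[lebesgue_measure]_t \int[P]_w ((\1_E (t, w))%:E * (H t w)%:E).
Proof.
move=> pE.
have mE : measurable E.
  have /= : <<s history_boxes>> E by exact: predictable_sub.
  apply: (@smallest_sub _ _ _ measurable); last exact: history_boxes_measurable.
  split; [exact: measurable0|by move=> ? ?; rewrite setTD; exact: measurableC|].
  by move=> ? ?; exact: bigcupT_measurable.
rewrite -hazard_measureE//.
apply: (@g_sigma_algebra_measure_unique _ _ _ history_boxes _
  (fun k => `](- k%:R)%R, k%:R]%classic `*` setT) _ _
  (campbell_measure P (@Knat i)) hazard_measure).
- exact: history_boxes_measurable.
- by move=> k; exists (- k%:R)%R, k%:R, (fun=> setT); split;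
    [move=> j; exact: process_historyT|congr (_ `*` _); apply/esym/seteqP; split].
- apply/seteqP; split => // -[x w] _; exists (Num.truncn `|x|).+1 => //=; split => //.
  have : (`|x| < (Num.truncn `|x|).+1%:R)%R by exact: truncnS_gt.
  by rewrite ltr_norml in_itv/= => /andP[-> /ltW].
- exact: history_boxesI.
- by move=> _ [a [b [A [HA ->]]]]; exact: hazard_measure_box.
- move=> k; rewrite /campbell_measure/= /campbell.
  rewrite (_ : (fun w => _) = fun w => K w `](- k%:R)%R, k%:R]%classic).
    by rewrite expectation_interval ?ltry// (le_trans _ (ler0n _ _))// oppr_le0.
  apply/funext => w; congr (K w _).
  by apply/seteqP; split => t; rewrite /ysection/= inE/= => // -[].
- exact: predictable_sub.
Qed.

End PredictableIntensity.

(** * Optimality of the hazard policy *)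

(** Each set difference is free of atoms, hence null for an integer-valued measure. *)
Lemma measure_eq_atoms (R : realType) (m : {measure set R -> \bar R}) (a b : R) (B B' : set R) :
  nat_valued m -> measurable B -> measurable B' ->
  B `<=` `]a, b[%classic -> B' `<=` `]a, b[%classic ->
  (forall s, 0 < m [set s] -> (B s <-> B' s)) -> m B = m B'.
Proof.
have D (V W : set R) : nat_valued m -> measurable V -> measurable W ->
    V `<=` `]a, b[%classic -> (forall s, 0 < m [set s] -> (V s <-> W s)) ->
    m V = m (V `&` W).
  move=> mnat mV mW Vab VW; rewrite (measureDI m mV mW).
  rewrite [X in X + _](_ : _ = 0) ?add0e//.
  apply: (nat_valued_no_atoms mnat _ (a := a) (b := b)).
  - exact: measurableD.
  - by move=> s [/Vab].
  - move=> s [Vs nWs]; apply/eqP; rewrite eq_le measure_ge0 andbT leNgt.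
    by apply/negP => /VW [/(_ Vs)].
move=> mnat mB mB' Bab B'ab BB'.
rewrite (D B B')// (D B' B) 1?setIC// => s /BB'; tauto.
Qed.

(** * Maximality of the sum of the C top-ranked values *)

Section Ranking.
Context {R : realType} {N : nat}.

Definition top_ranked (s : {perm 'I_N}) (C : nat) : {set 'I_N} :=
  [set s k | k : 'I_N & (k < C)%N]%SET.

Lemma card_top_ranked s C : (C < N)%N -> #|top_ranked s C| = C.
Proof.
move=> CN; rewrite card_imset; last exact: perm_inj.
rewrite -sum1_card -[RHS]subn0 -[RHS]muln1 -sum_nat_const_nat big_mkord.
rewrite [RHS](big_ord_widen N (fun=> 1%N))//; last exact: ltnW.
by apply: eq_bigl => k; rewrite inE.
Qed.

Lemma sum_top_ranked (v : 'I_N -> R) (s : {perm 'I_N}) C (S : {set 'I_N}) :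
  (C < N)%N -> (forall i, 0 <= v i)%R ->
  (forall j k : 'I_N, (j <= k)%N -> (v (s k) <= v (s j))%R) ->
  (#|S| <= C)%N ->
  (\sum_(i in S) v i <= \sum_(i in top_ranked s C) v i)%R.
Proof.
move=> CN v0 vs SC; set T := top_ranked s C.
have cT : #|T| = C by exact: card_top_ranked.
(* The value of the first item left out, which exists since C < N, separates the stored values from
   the others. Exchanging S for T then costs at most c per item of S outside T and gains at least c
   per item of T outside S; as c >= 0, a smaller S is no better. *)
pose c := v (s (Ordinal CN)).
have Tc i : i \in T -> (c <= v i)%R.
  by move=> /imsetP[k /[!inE] kC ->]; apply: vs; exact: ltnW.
have Tc' i : i \notin T -> (v i <= c)%R.
  move=> iT; rewrite -(permKV s i); apply: vs => /=; rewrite leqNgt.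
  apply: contra iT => kC; apply/imsetP; exists (s^-1%g i); rewrite ?inE//.
  by rewrite permKV.
rewrite (big_setID T)/= [leRHS](big_setID S)/= finset.setIC lerD2l.
apply: (@le_trans _ _ (\sum_(i in S :\: T) c)%R).
  by apply: ler_sum => i; rewrite inE => /andP[/Tc'].
apply: (@le_trans _ _ (\sum_(i in T :\: S) c)%R); last first.
  by apply: ler_sum => i; rewrite inE => /andP[_ /Tc].
rewrite !sumr_const; apply: ler_wpMn2l; first exact: v0.
by rewrite !cardsD finset.setIC leq_sub2r// cT.
Qed.

End Ranking.

Section PolicySums.
Context {d : measure_display} {Omega : measurableType d} {R : realType}.
Variable P : probability Omega R.

(** Policies compare pointwise only after summing over the items, so the sum is first moved inside
    both integrals. *)
Lemma double_integral_sum_le (I : finType) (f g : I -> R * Omega -> \bar R) :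
  (forall i, measurable_fun setT (f i)) -> (forall i p, 0 <= f i p) ->
  (forall i, measurable_fun setT (g i)) -> (forall i p, 0 <= g i p) ->
  (forall p, \sum_i f i p <= \sum_i g i p) ->
  \sum_i \int[lebesgue_measure]_t \int[P]_w f i (t, w) <=
  \sum_i \int[lebesgue_measure]_t \int[P]_w g i (t, w).
Proof.
have E (h : I -> R * Omega -> \bar R) :
    (forall i, measurable_fun setT (h i)) -> (forall i p, 0 <= h i p) ->
    \sum_i \int[lebesgue_measure]_t \int[P]_w h i (t, w) =
    \int[lebesgue_measure]_t \int[P]_w \sum_i h i (t, w).
  move=> mh h0; rewrite -ge0_integral_sum//.
  - apply: eq_integral => t _; rewrite ge0_integral_sum// => i.
    exact: (measurableT_comp (mh i) (measurable_pair1 t)).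
  - by move=> i; exact: (measurable_fun_fubini_tonelli_F (m2 := P) _ (mh i)).
  - by move=> i t _; exact: integral_ge0.
move=> mf f0 mg g0 fg; rewrite (E f mf f0) (E g mg g0).
have mS (h : I -> R * Omega -> \bar R) : (forall i, measurable_fun setT (h i)) ->
    measurable_fun setT (fun p => \sum_i h i p).
  by move=> mh; exact: emeasurable_sum.
apply: ge0_le_integral => //.
- by move=> t _; apply: integral_ge0 => w _; exact: sume_ge0.
- apply: (measurable_fun_fubini_tonelli_F (m2 := P) (fun p => \sum_i f i p) (mS _ mf)).
  by move=> p; exact: sume_ge0.
- apply: (measurable_fun_fubini_tonelli_F (m2 := P) (fun p => \sum_i g i p) (mS _ mg)).
  by move=> p; exact: sume_ge0.
move=> t _; apply: ge0_le_integral => //.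
- by move=> w _; exact: sume_ge0.
- exact: (measurableT_comp (mS _ mf) (measurable_pair1 t)).
- exact: (measurableT_comp (mS _ mg) (measurable_pair1 t)).
Qed.

End PolicySums.

(** * Predictability of the hazard policy and comparison of hit rates *)

Section Optimality.
Context {d : measure_display} {Omega : measurableType d} {R : realType}
  {N : nat}.
Variables (P : probability Omega R) (theta : R -> Omega -> Omega).
Variables (Phi : 'I_N -> R.-ker Omega ~> R) (f : 'I_N -> R -> R).
Variables (rk : N.-tuple R -> {perm 'I_N}) (C : nat).
Hypothesis flow : measurable_flow theta.
Hypothesis invP : flow_preserves P theta.
Hypothesis renewalPhi : forall i, stationary_renewal P theta (Phi i).
Hypothesis indepPhi : independent_processes P Phi.
Hypothesis intensityPhi : forall i, 0 < intensity P (Phi i) < +oo.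
Hypothesis densityPhi :
  forall i, is_density (inter_arrival_cdf P theta (Phi i)) (f i).
Hypothesis ltCN : (C < N)%N.
Hypothesis rankingP : ranking_rule rk.

Let pp i : point_process (Phi i). Proof. by case: (renewalPhi i) => -[]. Qed.
Let fc i : flow_compatible theta (Phi i).
Proof. by case: (renewalPhi i) => -[]. Qed.
Let simple i : simple_process P (Phi i). Proof. by case: (renewalPhi i). Qed.
Let Knat i w : nat_valued (Phi i w). Proof. exact: point_process_nat. Qed.

Let H i := current_hazard P theta (Phi i) (f i).
Let H_ge0 i t w : (0 <= H i t w)%R.
Proof. exact: (current_hazard_ge0 flow (@pp i) (intensityPhi i) (densityPhi i)). Qed.

Let pol := hazard_policy P theta Phi f rk C.

Lemma current_hazard_flow i s t w : H i s (theta t w) = H i (s + t)%R w.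
Proof.
rewrite /H /current_hazard.
have <- : last_before (Phi i (theta t w)) s + t%:E = last_before (Phi i w) (s + t)%R.
  by apply: last_before_compat => x; rewrite (@fc i)// image_set1.
case: last_before => [r||]; [congr (hazard_rate _ _ _)|exact: erefl|exact: erefl].
by rewrite opprD addrACA subrr addr0.
Qed.

Let X := g_sigma_algebraType [set E : set (R * Omega) | exists a b A,
  [/\ (a < b)%R, history Phi a A & E = `]a, b]%classic `*` A]].

(** What is known at b remains usable at all later times. This is the bridge from histories to the
    predictability of the last points. *)
Let predictable_after (b : R) (A : set Omega) : history Phi b A ->
  predictable Phi [set p | (b < p.1)%R /\ A p.2].
Proof.
move=> HA.
have -> : [set p : R * Omega | (b < p.1)%R /\ A p.2] =
    \bigcup_n (`]b, (b + n.+1%:R)%R]%classic `*` A).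
  apply/seteqP; split => [[t w]/= [bt Aw]|[t w] [n _ [/=]]]; last first.
    by rewrite in_itv/= => /andP[].
  exists (Num.truncn (t - b)) => //; split => //=; rewrite in_itv/= bt/=.
  by rewrite -lerBlDl ltW// truncnS_gt.
apply: (@bigcupT_measurable _ X) => n; apply: sub_sigma_algebra.
by exists b, (b + n.+1%:R)%R, A; split => //; rewrite ltrDl.
Qed.

Let historyT b : history Phi b setT.
Proof. by rewrite -(setD0 setT); apply: sigma_algebraCD; exact: sigma_algebra0. Qed.

Let predictable_time : measurable_fun (setT : set X) (fun p => p.1 : R).
Proof.
apply: (measurability _ (RGenOInfty.measurableE R)).
move=> _ [_ [b ->] <-]; rewrite setTI.
have := @predictable_after b setT (@historyT b); congr (predictable _ _).
by apply/seteqP; split => p /=; rewrite in_itv/= andbT; [case|].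
Qed.

Let predictable_last_before i :
  measurable_fun (setT : set X) (fun p => last_before (Phi i p.2) p.1).
Proof.
apply: (@measurable_last_before R _ X (fun p => Phi i p.2) _ (fun p => p.1)).
  by move=> p; exact: Knat.
move=> a b.
(* Histories are generated by nonempty intervals only; an empty one has no mass. *)
have [ab|ba] := ltP a b; last first.
  have -> : [set p : X | (b < p.1)%R /\ 0 < Phi i p.2 `]a, b]%classic] = set0.
    apply/seteqP; split => // p /= [_]; rewrite set_itv_ge ?measure0 ?ltxx//.
    by rewrite bnd_simp -leNgt.
  exact: (@measurable0 _ X).
apply: (@predictable_after b [set w | 0 < Phi i w `]a, b]%classic]).
apply: sub_sigma_algebra; exists i => //; apply: sub_sigma_algebra.
exists (a, b) => //=; exists [set x : \bar R | 0 < x]; last by rewrite setTI.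
by rewrite -set_itv_o_infty; exact: emeasurable_itv.
Qed.

Let hazards (p : X) : N.-tuple R := [tuple H i p.1 p.2 | i < N].

Let predictable_hazards : measurable_fun setT hazards.
Proof.
apply/measurable_fun_tnthP => i.
rewrite (_ : _ \o _ = fun p : X => H i p.1 p.2); last first.
  by apply/funext => p; rewrite /= /hazards tnth_mktuple.
apply: (measurable_current_hazard_comp flow (@pp i) (intensityPhi i) (densityPhi i)
  (X := X) (tau := fun p => p.1) (g := fun p => p.2)).
  exact: predictable_time.
exact: predictable_last_before.
Qed.

Let polE t w : pol t w = top_ranked (rk (hazards (t, w))) C.
Proof. by []. Qed.

Let hazards_flow s t w : hazards (s, theta t w) = hazards ((s + t)%R, w).
Proof. by apply: eq_mktuple => i; exact: current_hazard_flow. Qed.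

Let predictable_top_ranked (S : {set 'I_N}) :
  predictable Phi [set p | top_ranked (rk (hazards p)) C = S].
Proof.
have -> : [set p | top_ranked (rk (hazards p)) C = S] =
    \bigcup_(s in [set s | top_ranked s C = S]) hazards @^-1` [set v | rk v = s].
  apply/seteqP; split => [p pS|p [s sS /= ps]]; first by exists (rk (hazards p)).
  by rewrite /= ps.
apply: (@fin_bigcup_measurable _ X) => [|s _].
  exact: finite_finset.
rewrite -[X in measurable X]setTI; apply: predictable_hazards; first exact: measurableT.
by case: rankingP => _; exact.
Qed.

Lemma hazard_policy_causal : causal_policy theta Phi C pol.
Proof.
split.
- by move=> t w; rewrite polE card_top_ranked.
- by move=> s t w; rewrite !polE hazards_flow.
- move=> S; have := predictable_top_ranked S; congr (predictable _ _).
Qed.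

Lemma measurable_predictable E : predictable Phi E -> measurable E.
Proof.
apply: (@smallest_sub _ _ _ measurable).
  split; [exact: measurable0|by move=> ? ?; rewrite setTD; exact: measurableC|].
  by move=> ? ?; exact: bigcupT_measurable.
move=> _ [a [b [A [ab HA ->]]]]; apply: measurableX; first exact: measurable_itv.
move: HA; apply: (@smallest_sub _ _ _ measurable).
  split; [exact: measurable0|by move=> ? ?; rewrite setTD; exact: measurableC|].
  by move=> ? ?; exact: bigcupT_measurable.
by move=> B [j _]; exact: process_history_measurable.
Qed.

Section CausalPolicy.
Variable pol' : R -> Omega -> {set 'I_N}.
Hypothesis causal : causal_policy theta Phi C pol'.

Let stored i : set (R * Omega) := [set p | i \in pol' p.1 p.2].

Let predictable_stored i : predictable Phi (stored i).
Proof.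
have -> : stored i = \bigcup_(S in [set S : {set 'I_N} | i \in S])
    [set p | pol' p.1 p.2 = S].
  apply/seteqP; split => [p ip|p [S /= iS pS]]; first by exists (pol' p.1 p.2).
  by rewrite /stored/= pS.
apply: (@fin_bigcup_measurable _ X) => // S _.
by case: causal => _ _; exact.
Qed.

Definition hit_times i : set (R * Omega) :=
  (`]0%R, 1%R]%classic `*` setT) `&` [set p | i \in pol' p.1 p.2].

Lemma predictable_hit_times i : predictable Phi (hit_times i).
Proof.
apply: (@measurableI _ X); last exact: predictable_stored.
by apply: sub_sigma_algebra; exists 0%R, 1%R, setT; split.
Qed.

Lemma measurable_stored i w : measurable [set t | i \in pol' t w].
Proof.
have := measurable_ysection w (measurable_predictable (predictable_stored i)).
by congr measurable; apply/seteqP; split => t; rewrite /ysection/= inE.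
Qed.

Lemma measurable_stored_at i t : measurable [set w | i \in pol' t w].
Proof.
have := measurable_xsection t (measurable_predictable (predictable_stored i)).
by congr measurable; apply/seteqP; split => w; rewrite /xsection/= inE.
Qed.

Lemma hit_process_window w :
  hit_process Phi pol' w `]0%R, 1%R]%classic =
  \sum_(i < N) Phi i w (ysection (hit_times i) w).
Proof.
apply: eq_bigr => i _; rewrite integral_indic//; last exact: measurable_stored.
congr (Phi i w _); apply/seteqP; split => t; rewrite /ysection/= inE/=.
  by move=> [].
by move=> [[]].
Qed.

Lemma measurable_hit_process_window :
  measurable_fun setT (fun w => hit_process Phi pol' w `]0%R, 1%R]%classic).
Proof.
under eq_fun do rewrite hit_process_window.
apply: emeasurable_sum => i.
exact: (measurable_campbell_integrand (@Knat i)
  (measurable_predictable (predictable_hit_times i))).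
Qed.

Lemma hit_rate_hazard : hit_rate P Phi pol' =
  \sum_(i < N) \int[lebesgue_measure]_t \int[P]_w
    ((\1_(hit_times i) (t, w))%:E * (H i t w)%:E).
Proof.
rewrite /hit_rate; under eq_integral do rewrite hit_process_window.
rewrite ge0_integral_sum//; last first.
  move=> i; apply: measurable_campbell_integrand; first exact: Knat.
  exact: measurable_predictable (predictable_hit_times i).
apply: eq_bigr => i _.
exact: (campbell_predictable flow invP renewalPhi indepPhi intensityPhi densityPhi
  i (predictable_hit_times i)).
Qed.

End CausalPolicy.

Lemma hit_rate_hazard_policy pol' : causal_policy theta Phi C pol' ->
  hit_rate P Phi pol' <= hit_rate P Phi pol.
Proof.
move=> causal.
rewrite (hit_rate_hazard causal) (hit_rate_hazard hazard_policy_causal).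
have mI p' (c : causal_policy theta Phi C p') i : measurable_fun setT
    (fun p : R * Omega => (\1_(hit_times p' i) p)%:E * (H i p.1 p.2)%:E).
  apply: emeasurable_funM; apply/measurable_EFinP.
    exact: (measurable_indic (measurable_predictable (predictable_hit_times c i))).
  exact: (measurable_current_hazard flow (@pp i) (intensityPhi i) (densityPhi i)).
have I0 p' i p : 0 <= (\1_(hit_times p' i) p)%:E * (H i p.1 p.2)%:E :> \bar R.
  by rewrite mule_ge0 ?lee_fin.
pose g p' i p := (\1_(hit_times p' i) p)%:E * (H i p.1 p.2)%:E.
apply: (@double_integral_sum_le _ _ _ P _ (g pol') (g pol)).
- exact: mI.
- exact: I0.
- exact: (mI _ hazard_policy_causal).
- exact: I0.
move=> [t w]; rewrite /g /=.
have [t01|t01] := pselect (`]0%R, 1%R]%classic t); last first.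
  rewrite big1 ?sume_ge0// => i _.
  by rewrite indicE memNset ?mul0e// => -[[]].
have E p' : \sum_(i < N) (\1_(hit_times p' i) (t, w))%:E * (H i t w)%:E =
    (\sum_(i in p' t w) H i t w)%:E.
  rewrite -sumEFin [RHS]big_mkcond; apply: eq_bigr => i _; rewrite indicE.
  case: ifPn => ip; first by rewrite mem_set ?mul1e//; split.
  by rewrite memNset ?mul0e// => -[_ /=]; rewrite (negbTE ip).
rewrite !E lee_fin; apply: sum_top_ranked => //.
  move=> j k jk; pose v := [tuple H i t w | i < N].
  by have [/(_ v j k jk)] := rankingP; rewrite !tnth_mktuple.
by case: causal.
Qed.

(** * Absence of common points *)

Let lambda i := fine (intensity P (Phi i)).

Let has_point i (a b : R) : set Omega := [set w | 0 < Phi i w `]a, b]%classic].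

Let has_point_sigma i a b : process_sigma (Phi i) (has_point i a b).
Proof.
apply: sub_sigma_algebra; exists `]a, b]%classic; first exact: measurable_itv.
exists [set x : \bar R | 0 < x]; last by rewrite setTI.
by rewrite -set_itv_o_infty; exact: emeasurable_itv.
Qed.

Let measurable_has_point i a b : measurable (has_point i a b).
Proof. exact: process_sigma_measurable (@has_point_sigma i a b). Qed.

(** Markov's inequality: an integer mass that is positive is at least 1. *)
Lemma probability_point i (a b : R) : (a <= b)%R ->
  P (has_point i a b) <= (lambda i * (b - a))%:E.
Proof.
move=> ab.
rewrite -(expectation_interval flow invP renewalPhi intensityPhi i ab).
rewrite -[has_point i a b]setIT -integral_indic//.
apply: ge0_le_integral => //.
- by apply/measurable_EFinP; exact: measurable_indic.
- by apply: measurable_kernel; exact: measurable_itv.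
move=> w _; rewrite indicE; case: (boolP (w \in has_point i a b)) => [/set_mem Kw|_] /=; last exact: measure_ge0.
rewrite leNgt; apply/negP => K1; move: Kw; rewrite /has_point /=.
have -> : Phi i w `]a, b]%classic = 0; last by rewrite ltxx.
apply: (nat_valued_lt1 (@Knat i w) (measurable_itv _) _ K1 (a := a) (b := b)).
exact: subset_itv_oc_cc.
Qed.

Section NoCommonPoint.
Variables i j : 'I_N.
Hypothesis ij : i != j.

Let indep_pair (A B : set Omega) : process_sigma (Phi i) A ->
  process_sigma (Phi j) B -> P (A `&` B) = P A * P B.
Proof.
move=> HA HB.
pose E k := if k == i then A else if k == j then B else setT.
have HE k : process_sigma (Phi k) (E k).
  rewrite /E; case: eqP => [->//|_]; case: eqP => [->//|_].
  by rewrite -(setD0 setT); apply: sigma_algebraCD; exact: sigma_algebra0.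
have := indepPhi HE.
have -> : [set w | forall k, E k w] = A `&` B.
  apply/seteqP; split => [w Ew|w [Aw Bw] k].
    by split; [have := Ew i|have := Ew j]; rewrite /E ?eqxx// eq_sym (negbTE ij).
  by rewrite /E; case: eqP => // _; case: eqP.
move=> ->; rewrite (bigD1 i)//= (bigD1 j)/=; last by rewrite eq_sym.
rewrite /E eqxx eq_sym (negbTE ij) eqxx big1 ?mule1// => k /andP[/negbTE -> /negbTE ->].
exact: probability_setT.
Qed.

Let share n k : set Omega :=
  has_point i (k%:R / n.+1%:R)%R (k.+1%:R / n.+1%:R)%R `&`
  has_point j (k%:R / n.+1%:R)%R (k.+1%:R / n.+1%:R)%R.

Let measurable_share n k : measurable (share n k).
Proof. exact: measurableI. Qed.

Let probability_share n k :
  P (share n k) <= (lambda i * lambda j / n.+1%:R ^+ 2)%:E.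
Proof.
have le k' : (k'%:R / n.+1%:R <= k'.+1%:R / n.+1%:R :> R)%R.
  by rewrite ler_pM2r ?ler_nat// invr_gt0.
rewrite indep_pair; [|exact: has_point_sigma|exact: has_point_sigma].
apply: le_trans (lee_pmul _ _ (probability_point i (le k)) (probability_point j (le k))) _ => //.
rewrite -EFinM lee_fin -mulrBl -natrB// subSnn mul1r.
by rewrite expr2 invfM mulrACA.
Qed.

Let probability_some_share n :
  P (\big[setU/set0]_(k < n.+1) share n k) <= (lambda i * lambda j / n.+1%:R)%:E.
Proof.
apply: le_trans (@Boole_inequality _ _ _ P (share n) n.+1
  (fun k _ => measurable_share n k)) _.
apply: (@le_trans _ _ (\sum_(k < n.+1) (lambda i * lambda j / n.+1%:R ^+ 2)%:E)).
  by apply: lee_sum => k _; exact: probability_share.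
rewrite sumEFin lee_fin sumr_const card_ord -[leLHS]mulr_natr -mulrA.
by rewrite expr2 invfM !mulrA divfK.
Qed.

Lemma no_common_point : {ae P, forall w, forall s, (0 < s <= 1)%R ->
  0 < Phi i w [set s] -> Phi j w [set s] = 0}.
Proof.
exists (\bigcap_n \big[setU/set0]_(k < n.+1) share n k); split.
- by apply: bigcapT_measurable => n; apply: bigsetU_measurable.
- apply/eqP; rewrite eq_le measure_ge0 andbT; apply/lee_addgt0Pr => e e0.
  (* With this n, n + 1 exceeds lambda_i lambda_j / e, so the bound lambda_i lambda_j / (n + 1) is
     below e. *)
  rewrite add0e; pose n := Num.truncn (lambda i * lambda j / e).
  have mB : measurable (\bigcap_n \big[setU/set0]_(k < n.+1) share n k).
    by apply: bigcapT_measurable => m; apply: bigsetU_measurable.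
  apply: (@le_trans _ _ (P (\big[setU/set0]_(k < n.+1) share n k))).
    apply: le_measure; rewrite ?inE//; first by apply: bigsetU_measurable.
    exact: bigcap_inf.
  apply: le_trans (probability_some_share n) _.
  rewrite lee_fin ler_pdivrMr// [(e * _)%R]mulrC -ler_pdivrMr//.
  by rewrite ltW// truncnS_gt.
move=> w /= /existsNP[s /not_implyP[/andP[s0 s1] /not_implyP[Ki /eqP Kj]]] n _.
have s1n : (s <= n.+1%:R / n.+1%:R)%R by rewrite divff.
(* The cell containing s: s <= 1 bounds the least such k by n, and minimality gives k / (n + 1) <
   s. *)
have exk : exists k : nat, (s <= k.+1%:R / n.+1%:R)%R by exists n.
case: (ex_minnP exk) => k sk kmin.
have kn : (k < n.+1)%N by rewrite ltnS; exact: kmin.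
rewrite -bigcup_mkord; exists k => //.
have ks : (k%:R / n.+1%:R < s)%R.
  case: k {sk kn} kmin => [|k] kmin; first by rewrite mul0r.
  by rewrite ltNge; apply/negP => /kmin; rewrite ltnn.
have sI : [set s] `<=` `](k%:R / n.+1%:R)%R, (k.+1%:R / n.+1%:R)%R]%classic.
  by move=> _ ->; rewrite /= in_itv/= ks.
split.
  by apply: lt_le_trans Ki _; apply: le_measure; rewrite ?inE.
apply: (@lt_le_trans _ _ (Phi j w [set s])); first by rewrite lt0e Kj /=.
by apply: le_measure; rewrite ?inE.
Qed.

End NoCommonPoint.

(** * The hit probability as a normalized hit rate *)

Let S := superposition_kernel Phi.

Let Spp : point_process S.
Proof.
move=> w a b B mB Bab.
change (exists n : nat, \sum_(i < N) Phi i w B = n%:R%:E).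
apply: (big_ind (fun x => exists n : nat, x = n%:R%:E)).
- by exists 0%N.
- by move=> _ _ [n ->] [m ->]; exists (n + m)%N; rewrite natrD.
- by move=> i _; exact: (@pp i w a b).
Qed.

Section HitProbability.
Variable pol' : R -> Omega -> {set 'I_N}.
Hypothesis causal : causal_policy theta Phi C pol'.

Lemma hit_process_at0 w : hit_process Phi pol' w [set 0%R] =
  \sum_(i < N) (\1_[set w | i \in pol' 0%R w] w)%:E * Phi i w [set 0%R].
Proof.
apply: eq_bigr => i _.
rewrite -integral_cst//; apply: eq_integral => t; rewrite inE => ->.
by congr (_%:E); apply: indic_iff.
Qed.

Let hit_now : set Omega := [set w | hit_process Phi pol' w [set 0%R] = 1].

Let measurable_hit_now : measurable hit_now.
Proof.
have mh : measurable_fun setT (fun w => hit_process Phi pol' w [set 0%R]).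
  under eq_fun do rewrite hit_process_at0.
  apply: emeasurable_sum => i; apply: emeasurable_funM.
    apply/measurable_EFinP; apply: measurable_indic.
    exact: (measurable_stored_at causal).
  exact: measurable_kernel.
have := mh measurableT _ (emeasurable_set1 1); rewrite setTI; congr measurable.
Qed.

(** When item i alone is requested at s, the hit process seen from s reduces at 0 to one indicator,
    and compatibility with the flow turns the policy at 0 into the policy at s. *)
Let hit_now_at w s i : (0 < s <= 1)%R -> (forall i, Phi i w [set s] <= 1) ->
  0 < Phi i w [set s] -> (forall j, i != j -> Phi j w [set s] = 0) ->
  hit_now (theta s w) <-> i \in pol' s w.
Proof.
move=> s01 simple' Ki Kj.
have K1 : Phi i w [set s] = 1.
  apply/eqP; rewrite eq_le simple' leNgt; apply/negP => K1; move: Ki.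
  rewrite (nat_valued_lt1 (@Knat i w) (measurable_set1 s) _ K1 (a := s) (b := s)) ?ltxx//.
  by rewrite set_itv1.
have Ks k : Phi k (theta s w) [set 0%R] = Phi k w [set s].
  by rewrite (@fc k)// image_set1 add0r.
rewrite /hit_now/= hit_process_at0 (bigD1 i)//= big1 ?adde0; last first.
  by move=> j ji; rewrite Ks Kj ?mule0// eq_sym.
have polE' : pol' 0%R (theta s w) = pol' s w.
  by case: causal => _ ->; rewrite add0r.
rewrite Ks K1 mule1 indicE; case: (boolP (i \in pol' s w)) => ip.
  by rewrite mem_set//= polE'.
rewrite memNset/=; last by rewrite polE' (negbTE ip).
by split => // -[/eqP]; rewrite eq_sym oner_eq0.
Qed.

(** Almost surely the points in ]0, 1] are simple and belong to one process each. For every i, the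
    times from which a hit is seen at the origin then agree with the hit times of item i at the
    atoms of [Phi i], hence in mass. *)
Lemma hit_probability_rate : hit_probability P theta Phi pol' =
  ((fine (intensity P S))^-1)%:E * hit_rate P Phi pol'.
Proof.
rewrite /hit_probability (palm_massE P flow S measurable_hit_now).
congr (_ * _); apply: ge0_ae_eq_integral.
- by [].
- exact: (measurable_palm_integrand flow Spp measurable_hit_now).
- exact: measurable_hit_process_window causal.
- by move=> w _; exact: measure_ge0.
- by move=> w _; rewrite hit_process_window//; exact: sume_ge0.
have ae1 := filter_forall _ simple.
have ae2 : {ae P, forall w, forall i j, i != j -> forall s, (0 < s <= 1)%R ->
    0 < Phi i w [set s] -> Phi j w [set s] = 0}.
  apply: filter_forall => i; apply: filter_forall => j.
  have [->|ij] := eqVneq i j; first exact: filterE.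
  by move: (no_common_point ij); apply: filterS => w h _.
have : {ae P, forall w, (forall i t, Phi i w [set t] <= 1) /\
    (forall i j, i != j -> forall s, (0 < s <= 1)%R ->
      0 < Phi i w [set s] -> Phi j w [set s] = 0)}.
  by apply: filterI; [exact: ae1|exact: ae2].
apply: filterS => w [good1 good2] _.
rewrite hit_process_window//; apply: eq_bigr => i _.
have mh : measurable (ysection (hit_times pol' i) w).
  by apply: measurable_ysection; exact: measurable_predictable (predictable_hit_times causal i).
have sub01 : (`]0%R, 1%R]%classic : set R) `<=` `](-1)%R, 2%R[%classic.
  move=> s /=; rewrite !in_itv/= => /andP[s0 s1].
  by rewrite (lt_trans _ s0) ?ltrN10//= (le_lt_trans s1)// ltr1n.
apply: (measure_eq_atoms (@Knat i w) _ mh (a := (-1)%R) (b := 2%R)).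
- by apply: measurableI => //; exact: measurable_flow_section.
- by move=> s [/sub01].
- by move=> s; rewrite /ysection/= inE => -[[/sub01]].
move=> s Ks; rewrite /ysection/= inE/=.
have hitE (s01 : (0 < s <= 1)%R) := hit_now_at s01 (good1^~ s) Ks
  (fun j ij => good2 _ _ ij s s01 Ks).
split; first by move=> [s01 hs]; split => //; apply/hitE => //; rewrite -in_itv.
by move=> [[s01 _] ip]; split => //; apply/hitE.
Qed.

End HitProbability.

Lemma hit_probability_hazard_policy pol' : causal_policy theta Phi C pol' ->
  hit_probability P theta Phi pol' <= hit_probability P theta Phi pol.
Proof.
move=> causal.
rewrite (hit_probability_rate causal) (hit_probability_rate hazard_policy_causal).
apply: lee_wpmul2l; last exact: hit_rate_hazard_policy.
by rewrite lee_fin invr_ge0 fine_ge0// integral_ge0.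
Qed.

End Optimality.

Unset Implicit Arguments.

Theorem corollary1 (R : realType) (d : measure_display)
    (Omega : measurableType d) (P : probability Omega R)
    (theta : R -> Omega -> Omega) (N C : nat)
    (Phi : 'I_N -> R.-ker Omega ~> R) (f : 'I_N -> R -> R)
    (rk : N.-tuple R -> {perm 'I_N})
    (flow : measurable_flow theta)
    (invP : flow_preserves P theta)
    (ltCN : (C < N)%N)
    (renewalPhi : forall i, stationary_renewal P theta (Phi i))
    (indepPhi : independent_processes P Phi)
    (intensityPhi : forall i, 0 < intensity P (Phi i) < +oo)
    (densityPhi : forall i,
      is_density (inter_arrival_cdf P theta (Phi i)) (f i))
    (rankingP : ranking_rule rk) :
  optimal_causal_policy P theta Phi C (hazard_policy P theta Phi f rk C).
Proof.
split; first exact: hazard_policy_causal.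
move=> pol' causal; split.
- exact: hit_rate_hazard_policy.
- exact: hit_probability_hazard_policy.
Qed.
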